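(* Let $V$ be a finite dimensional graded vector space over a field $\mathbb K$ of characteristic $0$. (i) Let $(\mathcal C(V),\{\ ,\ \},\Omega)$ be an associative Pinczon algebra. Then there is a unique symplectic form $B$ on $V[1]$ (the one associated to the Pinczon bracket $\{\ ,\ \}$) and a unique $B$-quadratic coderivation $Q$ of $(\bigotimes^+V[1],\Delta)$ such that $\Omega=\Omega_Q$. (ii) Conversely, if $V$ is equipped with a degree $0$, non degenerate, symmetric bilinear form $b$, with associated symplectic form $B$ on $V[1]$ and associated Pinczon bracket $\{\ ,\ \}$, then any $B$-quadratic structure $Q$ of $A_\infty$ algebra on $V$ defines a unique associative Pinczon algebra $(\mathcal C(V),\{\ ,\ \},\Omega_Q)$.
   Context: Grading and signs. $|x|$ is the degree of a homogeneous $x\in V$; $V[1]$ is the same space with degree $\deg(x)=|x|-1$. Multilinear forms on $V[1]$ are graded with scalars in degree $0$. Koszul's sign rule is used everywhere: each term in which graded letters appear in an order differing from that of the first term by a permutation $\sigma$ carries the implicit sign of $\sigma$ computed by taking into account only the letters of odd degree (for $\deg$). Cyclic forms. An $n$-linear form $\Omega$ on $V[1]$ is cyclic if $\Omega(x_n,x_1,\ldots,x_{n-1})=\Omega(x_1,\ldots,x_n)$ (Koszul sign). $\mathcal C^n$ is the space of $n$-linear cyclic forms, $\mathcal C^0=\mathbb K$, and $\mathcal C(V)$ is the space of all cyclic multilinear forms. For an $n$-linear form, $\Omega^{Cycl}=\sum_\tau\Omega^\tau$, the sum over the subgroup of $\mathfrak S_n$ generated by $(1,2,\ldots,n)$, with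 $\Omega^\tau(x_1,\ldots,x_n)=\Omega(x_{\tau^{-1}(1)},\ldots,x_{\tau^{-1}(n)})$. Pinczon bracket. A Pinczon bracket on $\mathcal C(V)$ is a bilinear map $\{\ ,\ \}$ such that: (1) $\{\mathcal C^{k+1},\mathcal C^{k'+1}\}\subset\mathcal C^{k+k'}$; (2) it is a graded Lie bracket on $\mathcal C(V)$ (antisymmetry and Jacobi with Koszul signs); (3) $\{\alpha,(\beta_1\otimes\cdots\otimes\beta_k)^{Cycl}\}=\sum_j\{\alpha,\beta_j\}(\beta_1\otimes\cdots\hat{\beta_j}\cdots\otimes\beta_k)^{Cycl}$ for linear forms $\alpha,\beta_j$; (4) $\{\Omega,\mathcal C(V)\}=0$ iff $\Omega\in\mathcal C^0$. Pinczon brackets correspond bijectively to degree $0$, symmetric, non degenerate bilinear forms $b$ on $V$ through $\{\Omega,\Omega'\}=\sum_i(\iota_{e_i}\Omega\otimes\iota_{e'_i}\Omega')^{Cycl}$, where $(e_i)$ is a basis of $V$, $b(e_i,e'_j)=\delta_{ij}$, and $\iota_x$ is insertion of $x$ in one slot. The symplectic form on $V[1]$ associated to $b$ (hence to $\{\ ,\ \}$) is $B(x,y)=(-1)^{\deg(x)}b(x,y)$. Associative Pinczon algebra. An associative Pinczon algebra $(\mathcal C(V),\{\ ,\ \},\Omega)$ is a vector space $V$ such that $\mathcal C(V)$ is equipped with a Pinczon bracket $\{\ ,\ \}$, and an element $\Omega$ of $\mathcal C(V)$, with degree $3$, such that $\{\Omega,\Omega\}=0$. Coderivations. $\Delta(x_1\otimes\cdots\otimes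 x_k)=\sum_{r=1}^{k-1}(x_1\otimes\cdots\otimes x_r)\bigotimes(x_{r+1}\otimes\cdots\otimes x_k)$ on $\bigotimes^+V[1]=\sum_{k>0}\bigotimes^kV[1]$. A coderivation $Q$ of $\Delta$ is the same as its sequence of Taylor coefficients $Q_k:\bigotimes^kV[1]\to V[1]$, $k\ge1$. For $k$-linear $Q$, $\Omega_Q(x_1,\ldots,x_{k+1})=B(Q(x_1,\ldots,x_k),x_{k+1})$, and for a coderivation $\Omega_Q=\sum_k\Omega_{Q_k}$; $Q$ is $B$-quadratic if every $\Omega_{Q_k}$ is cyclic. An $A_\infty$ algebra structure on $V$ is a degree $1$ coderivation $Q$ of $\Delta$ on $\bigotimes^+V[1]$ with $[Q,Q]=0$ (graded commutator of coderivations).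
   Formalization: In (i), Ω is assumed to have no linear part; axiom (4)'s converse, false for every b on V≠0, is kept only for arity ≤ 2; in (i) the form b attached to the bracket is read from {a,g} with a linear; C(V) consists of formal series, with bracket computed componentwise. *)

(* Defs.v *)
From HB Require Import structures.
From mathcomp Require Import all_boot all_order all_algebra.
From mathcomp Require Import boolp functions.

Set Implicit Arguments.
Unset Strict Implicit.
Unset Printing Implicit Defensive.

Import GRing.Theory Num.Theory.
Local Open Scope ring_scope.

Record grading (K : fieldType) (V : vectType K) := Grading {
  gpart :> int -> {vspace V};
  gradingP : exists s : seq int,
    [/\ uniq s, forall i, i \notin s -> gpart i = 0%VS,
        directv (\sum_(i <- s) gpart i)
      & (\sum_(i <- s) gpart i)%VS = fullv] }.

Section Maps.
Variable K : fieldType.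

Definition bilinear_map (U U' W : lmodType K) (f : U -> U' -> W) : Prop :=
  (forall y, linear (f^~ y)) /\ (forall x, linear (f x)).

(* A family of n-linear maps, one for each n, is a map on finite sequences:
   its n-linear component is the restriction to sequences of size n.  Hence
   such a map is a formal series of multilinear maps. *)
Definition multilinear (V W : lmodType K) (F : seq V -> W) : Prop :=
  forall (s t : seq V) (a : K) (x y : V),
    F (s ++ (a *: x + y) :: t) = a *: F (s ++ x :: t) + F (s ++ y :: t).

End Maps.

Section CyclicForms.
Variables (K : fieldType) (V : vectType K) (G : grading V).
Implicit Types (w : seq (int * V)) (F : seq V -> K^o).

(* Koszul signs only make sense on homogeneous vectors.  A word is a sequence of
   pairs (i, x), where x lies in the component of V of degree i; x has degree
   i - 1 in V[1].  Words record degrees because 0 has no degree of its own. *)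
Definition homword w : bool := all (fun p => p.2 \in G p.1) w.

Definition wdeg w : int := \sum_(p <- w) (p.1 - 1).

Definition koszul_cyclic F : Prop :=
  forall w (i : int) (x : V), homword (rcons w (i, x)) ->
    F (x :: unzip2 w) = (-1) ^ ((i - 1) * wdeg w) * F (rcons (unzip2 w) x).

Definition cyclic_pred : {pred seq V -> K^o} :=
  fun F => `[< multilinear F /\ koszul_cyclic F >].

Lemma cyclic_pred_submod : GRing.submod_closed cyclic_pred.
Proof.
split; first by apply/asboolP; split=> [s t a x y|w i x _]; rewrite /= ?scaler0 ?mulr0 ?addr0.
move=> c F1 F2 /asboolP[m1 k1] /asboolP[m2 k2]; apply/asboolP; split.
  move=> s t a x y; rewrite /= !fctE m1 m2 !scalerDr !scalerA.
  by rewrite [a * c]mulrC addrACA.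
move=> w i x hw; rewrite !fctE (k1 _ _ _ hw) (k2 _ _ _ hw) mulrDr; congr (_ + _).
exact: mulrCA.
Qed.

HB.instance Definition _ :=
  GRing.isSubmodClosed.Build K (seq V -> K^o) cyclic_pred cyclic_pred_submod.

(* The space C(V), completed with respect to the arity: the coderivations of the
   tensor coalgebra have infinitely many Taylor coefficients in general, so that
   the form attached to one of them is a formal series. *)
Record cform := CForm { cval :> seq V -> K^o; _ : cval \in cyclic_pred }.

HB.instance Definition _ := [isSub for cval].
HB.instance Definition _ := [Choice of cform by <:].
HB.instance Definition _ := [SubChoice_isSubLmodule of cform by <:].

Implicit Types (f g h : cform) (br : cform -> cform -> cform).

Definition has_arity (n : nat) f : Prop := forall s, size s != n -> f s = 0.

Definition vanish_upto (n : nat) f : Prop :=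
  forall s, (size s <= n)%N -> f s = 0.

(* Scalars are in degree 0. *)
Definition has_degree (p : int) f : Prop :=
  forall w, homword w -> f (unzip2 w) != 0 -> wdeg w = - p.

(* The sum over the group generated by the cycle (1, 2, ..., n).  This group
   has n elements if n > 0, and one element if n = 0. *)
Definition cycl (F : seq (int * V) -> K) w : K :=
  \sum_(r < maxn 1 (size w))
    (-1) ^ (wdeg (take r w) * wdeg (drop r w)) * F (rot r w).

Definition is_cycl f (F : seq (int * V) -> K) : Prop :=
  forall w, homword w -> f (unzip2 w) = cycl F w.

(* The tensor product of a list of linear forms, each of them paired with its
   degree; the sign moves the arguments past the forms. *)
Fixpoint tensor (bs : seq (int * cform)) w : K :=
  match bs, w with
  | [::], [::] => 1
  | b :: bs', p :: w' =>
      (-1) ^ ((\sum_(c <- bs') c.1) * (p.1 - 1)) * b.2 [:: p.2] * tensor bs' w'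
  | _, _ => 0
  end.

(* {C^(k+1), C^(k'+1)} is contained in C^(k+k'), and the bracket is computed
   componentwise on formal series. *)
Definition arity_axiom br : Prop :=
  (forall k k' f g, has_arity k.+1 f -> has_arity k'.+1 g ->
     has_arity (k + k') (br f g))
  /\ (forall n f g, vanish_upto n.+2 f ->
        vanish_upto n (br f g) /\ vanish_upto n (br g f)).

(* The bracket has the degree -2 of the inverse of the symplectic form. *)
Definition graded_lie br : Prop :=
  [/\ forall p q f g, has_degree p f -> has_degree q g ->
        has_degree (p + q - 2) (br f g),
      forall p q f g, has_degree p f -> has_degree q g ->
        br f g = - ((-1) ^ (p * q) *: br g f)
    & forall p q r f g h,
        has_degree p f -> has_degree q g -> has_degree r h ->
        (-1) ^ (p * r) *: br (br f g) h + (-1) ^ (q * p) *: br (br g h) f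
        + (-1) ^ (r * q) *: br (br h f) g = 0].

Definition derivation_axiom br : Prop :=
  forall (a : cform) (bs : seq (int * cform)) (f : cform),
    has_arity 1 a ->
    {in bs, forall b, has_arity 1 b.2 /\ has_degree b.1 b.2} ->
    is_cycl f (tensor bs) ->
    forall w, homword w ->
      br a f (unzip2 w) =
        \sum_(j < size bs)
          (-1) ^ ((nth (0, 0) bs j).1 * \sum_(c <- take j bs) c.1)
          * br a (nth (0, 0) bs j).2 [::]
          * cycl (tensor (take j bs ++ drop j.+1 bs)) w.

(* Constants are central, and conversely a form of arity at most 2 is constant
   as soon as it is central.  The converse cannot hold in all arities: writing
   omega for the form b read on V[1], the cyclization of the tensor product of
   omega with itself is central, and in dimension 1 so is the cube of a linear
   form. *)
Definition center_axiom br : Prop :=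
  (forall f, has_arity 0 f -> forall g, br f g = 0)
  /\ (forall f, (forall s, (2 < size s)%N -> f s = 0) ->
        (forall g, br f g = 0) -> has_arity 0 f).

Definition pinczon_bracket br : Prop :=
  [/\ bilinear_map br, arity_axiom br, graded_lie br, derivation_axiom br
    & center_axiom br].

Definition assoc_pinczon br (Omega : cform) : Prop :=
  [/\ pinczon_bracket br, has_degree 3 Omega & br Omega Omega = 0].

(* Degree 0, symmetric (with the sign given by the degrees in V) and non
   degenerate. *)
Definition quadratic_form (b : V -> V -> K^o) : Prop :=
  [/\ bilinear_map b,
      forall i j x y, x \in G i -> y \in G j -> b x y != 0 -> i + j = 0,
      forall i j x y, x \in G i -> y \in G j -> b y x = (-1) ^ (i * j) * b x y
    & forall x, (forall y, b x y = 0) -> x = 0].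

(* The degree in V[1] of the arguments of a non zero B x y sums up to -2. *)
Definition symplectic_form (B : V -> V -> K^o) : Prop :=
  [/\ bilinear_map B,
      forall i j x y, x \in G i -> y \in G j -> B x y != 0 -> i + j = 0,
      forall i j x y, x \in G i -> y \in G j ->
        B y x = - ((-1) ^ ((i - 1) * (j - 1)) * B x y)
    & forall x, (forall y, B x y = 0) -> x = 0].

Definition symplectic_of (b B : V -> V -> K^o) : Prop :=
  bilinear_map B /\
  forall i x y, x \in G i -> B x y = (-1) ^ (i - 1) * b x y.

(* The sum over i of iota_(e_i) f (x) iota_(e'_i) g, where d_i is the degree of
   e_i in V.  The sign is the Koszul sign of
     f, g, e_i, e'_i, u, v  ~>  f, e_i, u, g, e'_i, v,
   where e_i and e'_i have the same parity, and where the degree of g is the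
   opposite of the degree of its arguments e'_i and v unless the term is 0. *)
Definition contraction (n : nat) (d : n.-tuple int) (e e' : n.-tuple V) f g w
    : K :=
  \sum_(k < (size w).+1) \sum_(i < n)
    let u := take k w in let v := drop k w in
    let ei : int := tnth d i - 1 in
    (-1) ^ (ei * wdeg u + (ei + wdeg v) * (ei + wdeg u))
    * f (tnth e i :: unzip2 u) * g (tnth e' i :: unzip2 v).

Definition bracket_formula (b : V -> V -> K^o) br f g : Prop :=
  forall (n : nat) (d : n.-tuple int) (e e' : n.-tuple V),
    basis_of fullv e -> (forall i, tnth e i \in G (tnth d i)) ->
    (forall i j, b (tnth e i) (tnth e' j) = (i == j)%:R) ->
    is_cycl (br f g) (contraction d e e' f g).

Definition bracket_of (b : V -> V -> K^o) br : Prop :=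
  forall f g, bracket_formula b br f g.

(* The form b attached to a Pinczon bracket is read on the brackets with linear
   forms.  The axioms of a Pinczon bracket imply the formula for these brackets
   only. *)
Definition form_of br (b : V -> V -> K^o) : Prop :=
  quadratic_form b
  /\ (forall a g, has_arity 1 a -> bracket_formula b br a g).

Definition associated_symplectic br (B : V -> V -> K^o) : Prop :=
  exists2 b, form_of br b & symplectic_of b B.

(* A coderivation of the tensor coalgebra is given by its Taylor coefficients
   Q_k for k >= 1. *)
Definition coderivation (Q : seq V -> V) : Prop :=
  Q [::] = 0 /\ multilinear Q.

Definition omega_of (B : V -> V -> K^o) (Q : seq V -> V) : seq V -> K^o :=
  fun s => if s is x :: t then B (Q (belast x t)) (last x t) else 0.

Definition B_quadratic (B : V -> V -> K^o) (Q : seq V -> V) : Prop :=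
  koszul_cyclic (omega_of B Q).

Definition coder_degree (p : int) (Q : seq V -> V) : Prop :=
  forall w, homword w -> Q (unzip2 w) \in G (wdeg w + p + 1).

(* Taylor coefficients of the composite of the coderivation with coefficients Q
   and of the coderivation of degree q with coefficients Q'. *)
Definition coder_comp (q : int) (Q Q' : seq V -> V) w : V :=
  \sum_(i < size w) \sum_(j < size w - i)
    (-1) ^ (q * wdeg (take i w)) *:
      Q (unzip2 (take i w) ++ Q' (unzip2 (take j.+1 (drop i w)))
           :: unzip2 (drop (i + j.+1) w)).

Definition coder_commutator (p q : int) (Q Q' : seq V -> V) w : V :=
  coder_comp q Q Q' w - (-1) ^ (p * q) *: coder_comp p Q' Q w.

Definition A_infinity (Q : seq V -> V) : Prop :=
  [/\ coderivation Q, coder_degree 1 Q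
    & forall w, homword w -> coder_commutator 1 1 Q Q w = 0].

End CyclicForms.

(* Main.v *)
(** In a homogeneous basis e of V, a cyclic form is a function on words of basis
    indices which is cyclic up to a Koszul sign, and the bracket of f and g at w
    is the signed sum, over all ways of cutting the cyclic word w into two arcs
    u and v, of N_ij f(e_i u) g(e_j v), with N the copairing of b.  In
    {{f, g}, h} the pieces of w attached to the outer forms are two arcs of w,
    separated by two arcs attached to the middle form; the terms where g is in
    the middle cancel those of {{g, h}, f}, hence the Jacobi identity.

    By cyclicity, {Omega_Q, Omega_Q}(u, x) is, up to a sign, twice
    B((Q o Q)(u), x): each cyclic cut appears twice, according to the arc that
    contains x.

    For a linear form a, the derivation axiom and continuity determine {a, .}
    from its values on linear forms, since in characteristic 0 the cyclized
    products of coordinate forms span the forms of any given arity.  Hence a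
    linear form which pairs to 0 with all linear forms is central, so it is 0;
    the pairing of linear forms is then non degenerate, and b is its inverse. *)

Require Import Defs.
From mathcomp Require Import all_boot all_order all_algebra.
From mathcomp Require Import boolp functions ring zify.

Set Implicit Arguments.
Unset Strict Implicit.
Unset Printing Implicit Defensive.

Import GRing.Theory Num.Theory.
Local Open Scope ring_scope.

(** * Cyclic words and their Koszul signs *)

(** Signs are the main obstacle. Only parities enter them, so a sign is [sg] of a boolean and a
    product of Koszul signs is one xor; a sign identity becomes a truth table once the terms that
    vanish for parity reasons are discarded. Passing to index words is legitimate although the
    identities contain signs read from recorded degrees: such expressions remain linear in each
    letter with its degree fixed, and a homogeneous vector only involves basis vectors of its own
    degree. Cuts are summed by recursion on the word, so that nested cuts are regrouped by
    induction, without index arithmetic. Marking one letter of a cyclic word turns a rotation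
    followed by a cut into nested linear cuts, and exchanging two arcs is then a mere regrouping.
    The shift of degree by 1 makes [N] antisymmetric; every cancellation in the Jacobi identity
    comes from this. Taylor coefficients start at k = 1, so a form Omega_Q has no component of arity
    0 or 1. In part (i), degree 3 excludes the constants, and the linear component is assumed to
    vanish. *)

Definition sg (K : pzRingType) (b : bool) : K := (-1) ^+ b.

Lemma sgD (K : pzRingType) a b : sg K (a (+) b) = sg K a * sg K b.
Proof. exact: signr_addb. Qed.

Lemma sgM (K : pzRingType) a b x : sg K a * (sg K b * x) = sg K (a (+) b) * x.
Proof. by rewrite mulrA sgD. Qed.

Section Parity.
Variables (T : Type) (par : T -> bool).
Implicit Types (u v w : seq T).

Definition word_parity w : bool := foldr (fun x b => par x (+) b) false w.

Lemma parity_cons x w : word_parity (x :: w) = par x (+) word_parity w.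
Proof. by []. Qed.

Lemma parity_cat u v : word_parity (u ++ v) = word_parity u (+) word_parity v.
Proof. by elim: u => //= x u ->; rewrite addbA. Qed.

Lemma parity_rcons w x : word_parity (rcons w x) = par x (+) word_parity w.
Proof. by rewrite -cats1 parity_cat /= addbF addbC. Qed.

End Parity.

Ltac parity_cases par :=
  rewrite ?(parity_cat, parity_cons, parity_rcons) /=;
  repeat match goal with
  | |- context [word_parity ?p ?w] => case: (word_parity p w)
  | |- context [par ?x] => case: (par x)
  | |- context [fst ?b] => case: (fst b)
  end; reflexivity.

Section Words.
Variables (K : comNzRingType) (T : Type) (par : T -> bool).
Implicit Types (u v w : seq T) (F : seq T -> K) (D : seq T -> seq T -> K).

Local Notation sg := (sg K).
Local Notation parity := (word_parity par).

(** Deconcatenation with empty pieces allowed: in a bracket, a form may receive nothing but its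
    contracted letter. *)
Fixpoint cut D w : K :=
  if w is x :: w' then D [::] w + cut (fun a b => D (x :: a) b) w'
  else D [::] [::].

Lemma eq_cut D D' w :
  (forall a b, a ++ b = w -> D a b = D' a b) -> cut D w = cut D' w.
Proof.
elim: w D D' => [|x w IHw] D D' eqD /=; first exact: eqD.
rewrite eqD //; congr (_ + _); apply: IHw => a b eqw.
by apply: eqD; rewrite /= eqw.
Qed.

Lemma cutE D w :
  cut D w = \sum_(k < (size w).+1) D (take k w) (drop k w).
Proof.
elim: w D => [|x w IHw] D; first by rewrite big_ord1.
by rewrite big_ord_recl /= IHw.
Qed.

Lemma cut0 w : cut (fun _ _ => 0) w = 0.
Proof. by rewrite cutE big1. Qed.

Lemma cutD D D' w : cut (fun a b => D a b + D' a b) w = cut D w + cut D' w.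
Proof. by rewrite !cutE big_split. Qed.

Lemma cutZ c D w : cut (fun a b => c * D a b) w = c * cut D w.
Proof. by rewrite !cutE mulr_sumr. Qed.

Lemma cut_sum (J : Type) (r : seq J) (D : J -> seq T -> seq T -> K) w :
  cut (fun a b => \sum_(j <- r) D j a b) w = \sum_(j <- r) cut (D j) w.
Proof. by rewrite cutE exchange_big; apply: eq_bigr => j _; rewrite cutE. Qed.

Lemma cut_cut (H : seq T -> seq T -> seq T -> seq T -> K) u v :
  cut (fun a b => cut (H a b) v) u =
  cut (fun c d => cut (fun a b => H a b c d) u) v.
Proof.
rewrite !cutE; under eq_bigr do rewrite cutE.
by rewrite exchange_big; apply: eq_bigr => k _; rewrite cutE.
Qed.

(** Coassociativity of deconcatenation. *)
Lemma cutA (H : seq T -> seq T -> seq T -> K) w :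
  cut (fun ab c => cut (fun a b => H a b c) ab) w =
  cut (fun a bc => cut (fun b c => H a b c) bc) w.
Proof.
elim: w H => //= x w IHw H; rewrite cutD IHw addrA; congr (_ + _).
Qed.

Lemma cut_mid D u x v :
  cut D (u ++ x :: v) =
  cut (fun a b => D a (b ++ x :: v)) u + cut (fun a b => D (u ++ x :: a) b) v.
Proof. by elim: u D => [|y u IHu] D //=; rewrite IHu addrA. Qed.

Lemma cut_rcons D w x :
  cut D (rcons w x) = cut (fun a b => D a (rcons b x)) w + D (rcons w x) [::].
Proof.
rewrite -cats1 cut_mid /=; congr (_ + _).
by apply: eq_cut => a b _; rewrite cats1.
Qed.

(* The rotations of [x :: u] are the words [d ++ x :: c] with [u = c ++ d]. *)
Definition rotsum F w : K :=
  if w is x :: u then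
    cut (fun c d => sg ((par x (+) parity c) && parity d) * F (d ++ x :: c)) u
  else F [::].

Lemma rotsumE F w :
  rotsum F w = \sum_(r < maxn 1 (size w))
    sg (parity (take r w) && parity (drop r w)) * F (rot r w).
Proof.
case: w => [|x u]; first by rewrite big_ord1 /= mul1r.
rewrite /rotsum cutE (maxn_idPr _ : maxn 1 (size (x :: u)) = (size u).+1) //.
rewrite [LHS]big_ord_recr [RHS]big_ord_recl addrC; congr (_ + _).
by rewrite take_size drop_size andbF /= rot0.
Qed.

Lemma eq_rotsum F F' w : F =1 F' -> rotsum F w = rotsum F' w.
Proof.
by move=> eqF; rewrite !rotsumE; apply: eq_bigr => r _; rewrite eqF.
Qed.

Lemma rotsumD F F' w :
  rotsum (fun v => F v + F' v) w = rotsum F w + rotsum F' w.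
Proof.
by rewrite !rotsumE -big_split; apply: eq_bigr => r _; rewrite mulrDr.
Qed.

Lemma rotsumZ c F w : rotsum (fun v => c * F v) w = c * rotsum F w.
Proof.
by rewrite !rotsumE mulr_sumr; apply: eq_bigr => r _; rewrite mulrCA.
Qed.

Lemma rotsum_sum (J : Type) (r : seq J) (F : J -> seq T -> K) w :
  rotsum (fun v => \sum_(j <- r) F j v) w = \sum_(j <- r) rotsum (F j) w.
Proof.
rewrite rotsumE; under eq_bigr do rewrite mulr_sumr.
by rewrite exchange_big; apply: eq_bigr => j _; rewrite rotsumE.
Qed.

Definition cyclic F : Prop :=
  forall x w, F (x :: w) = sg (par x && parity w) * F (rcons w x).

Lemma cyclic_cat F u v :
  cyclic F -> F (u ++ v) = sg (parity u && parity v) * F (v ++ u).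
Proof.
move=> cF; elim: u v => [|x u IHu] v; first by rewrite mul1r cats0.
rewrite cat_cons cF -cats1 -catA IHu sgM -catA /=; congr (sg _ * _).
rewrite !parity_cat /=.
by case: (par x); case: (parity u); case: (parity v).
Qed.

Lemma rotsum_cyclic F : cyclic (rotsum F).
Proof.
move=> x [|y u]; first by rewrite andbF mul1r.
rewrite rcons_cons /= cut_rcons mulrDr [RHS]addrC; congr (_ + _).
  by rewrite andbF mul1r addbF cats1.
rewrite -cutZ; apply: eq_cut => c d <-.
by rewrite sgM cat_rcons; congr (sg _ * _); parity_cases par.
Qed.

(** The letter [x] is marked. In a rotation [d ++ x :: c], the cut falls in [d], so that [x] is in
    the second arc, or in [c], so that [x] is in the first one. *)
Lemma rotsum_cut_cons D x u :
  rotsum (cut D) (x :: u) =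
  cut (fun c d => cut (fun d1 d2 =>
         sg ((par x (+) parity c) && parity (d1 ++ d2))
         * D d1 (d2 ++ x :: c)) d) u
  + cut (fun c d => cut (fun c1 c2 =>
         sg ((par x (+) parity (c1 ++ c2)) && parity d)
         * D (d ++ x :: c1) c2) c) u.
Proof.
rewrite /rotsum -cutD; apply: eq_cut => c d _.
rewrite cut_mid mulrDr -!cutZ.
by congr (_ + _); apply: eq_cut => a b ->.
Qed.

(** Exchanging the two arcs of a cyclic word is a rotation. With a marked letter, it swaps the two
    sums of [rotsum_cut_cons], up to coassociativity. *)
Lemma rotsum_cutC D w :
  rotsum (cut D) w =
  rotsum (cut (fun a b => sg (parity a && parity b) * D b a)) w.
Proof.
case: w => [|x u]; first by rewrite /= mul1r.
rewrite !rotsum_cut_cons addrC.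
rewrite (cutA (fun c1 c2 d => sg ((par x (+) parity (c1 ++ c2)) && parity d)
           * D (d ++ x :: c1) c2)).
rewrite (cutA (fun c1 c2 d => sg ((par x (+) parity (c1 ++ c2)) && parity d)
           * (sg (parity (d ++ x :: c1) && parity c2) * D c2 (d ++ x :: c1)))).
by congr (_ + _); apply: eq_cut => a b _; apply: eq_cut => c d _;
  rewrite sgM; congr (sg _ * _); parity_cases par.
Qed.

End Words.

(** * The bracket on index words *)

Section Bracket.
Variables (K : comNzRingType) (I : finType) (par : I -> bool).
Variable N : I -> I -> K.
Hypothesis N_antisym : forall i j, N i j = - (sg K (par i) * N j i).
Hypothesis N_par : forall i j, par i != par j -> N i j = 0.
Implicit Types (u v w : seq I) (phi psi chi : seq I -> K).

Local Notation parity := (word_parity par).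
Local Notation sg := (sg K).
Local Notation rotsum := (rotsum par).

Definition has_parity p phi := forall w, parity w != p -> phi w = 0.

Definition glue phi psi u v : K :=
  \sum_i \sum_j N i j *
    (sg ((par i (+) parity u) && parity v) * (phi (i :: u) * psi (j :: v))).

Definition bracket phi psi : seq I -> K := rotsum (cut (glue phi psi)).

Lemma glueC p q phi psi u v : has_parity p phi -> has_parity q psi ->
  sg (parity u && parity v) * glue phi psi v u
  = - (sg (p && q) * glue psi phi u v).
Proof.
move=> hp hq; rewrite /glue exchange_big /= !mulr_sumr -sumrN.
apply: eq_bigr => i _; rewrite !mulr_sumr -sumrN; apply: eq_bigr => j _.
have [eij|nij] := eqVneq (par j) (par i); last first.
  by rewrite !N_par ?mul0r ?mulr0 ?oppr0 // eq_sym.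
have [ep|np] := eqVneq (parity (j :: v)) p; last first.
  by rewrite (hp _ np) ?(mul0r, mulr0, oppr0).
have [eq|nq] := eqVneq (parity (i :: u)) q; last first.
  by rewrite (hq _ nq) ?(mul0r, mulr0, oppr0).
rewrite (N_antisym j i).
set s1 := sg _; set s2 := sg (par j); set s3 := sg _; set s4 := sg _.
set s5 := sg _.
(* In the remaining terms [i] and [j] have the same parity, and [p], [q] are the parities of the two
   arguments; the identity is Boolean in the parities of [i], [u] and [v]. *)
have es : s1 * s2 * s3 = s4 * s5.
  rewrite /s1 /s2 /s3 /s4 /s5 -!sgD -ep -eq; congr (sg _).
  by rewrite !parity_cons eij; parity_cases par.
transitivity (- (s1 * s2 * s3 * (N i j * (phi (j :: v) * psi (i :: u))))).
  by ring.
by rewrite es; ring.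
Qed.

Lemma bracket_antisym p q phi psi w : has_parity p phi -> has_parity q psi ->
  bracket phi psi w = - (sg (p && q) * bracket psi phi w).
Proof.
move=> hp hq; rewrite /bracket rotsum_cutC -mulNr -rotsumZ.
apply: eq_rotsum => {}w; rewrite -cutZ; apply: eq_cut => u v _.
by rewrite (glueC u v hp hq) mulNr.
Qed.

(* The two families of terms of the bracket of [bracket phi psi] with [chi]:
   [chi] is attached to [psi] in the first one, and to [phi] in the second. *)
Definition glue_right phi psi chi (c d1 d2 v : seq I) : K :=
  \sum_i \sum_j \sum_k \sum_l N i j * N k l *
    (sg (((par i (+) parity (c ++ d1 ++ d2)) && parity v)
         (+) ((par i (+) parity c) && parity (d1 ++ d2))
         (+) ((par k (+) parity d1) && parity (d2 ++ i :: c)))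
     * (phi (k :: d1) * psi (l :: d2 ++ i :: c) * chi (j :: v))).

Definition glue_left phi psi chi (c1 c2 d v : seq I) : K :=
  \sum_i \sum_j \sum_k \sum_l N i j * N k l *
    (sg (((par i (+) parity ((c1 ++ c2) ++ d)) && parity v)
         (+) ((par i (+) parity (c1 ++ c2)) && parity d)
         (+) ((par k (+) parity (d ++ i :: c1)) && parity c2))
     * (phi (k :: d ++ i :: c1) * psi (l :: c2) * chi (j :: v))).

(** The common shape of the two families: pieces 1 and 3 go to the middle form, pieces 2 and 4 to
    the outer ones. *)
Definition cut4 (H : seq I -> seq I -> seq I -> seq I -> K) : seq I -> K :=
  cut (fun u v => cut (fun a b => cut (fun c d => H a b c d) v) u).

Lemma cut4D H H' w :
  cut4 (fun a b c d => H a b c d + H' a b c d) w = cut4 H w + cut4 H' w.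
Proof.
rewrite /cut4 -cutD; apply: eq_cut => u v _; rewrite -cutD.
by apply: eq_cut => a b _; rewrite -cutD.
Qed.

Lemma cut4Z k H w : cut4 (fun a b c d => k * H a b c d) w = k * cut4 H w.
Proof.
rewrite /cut4 -cutZ; apply: eq_cut => u v _; rewrite -cutZ.
by apply: eq_cut => a b _; rewrite -cutZ.
Qed.

Lemma rotsum_cut4C H w : rotsum (cut4 H) w =
  rotsum (cut4 (fun a b c d =>
    sg (parity (a ++ b) && parity (c ++ d)) * H c d a b)) w.
Proof.
rewrite rotsum_cutC; apply: eq_rotsum => {}w; apply: eq_cut => u v _.
rewrite cut_cut -cutZ; apply: eq_cut => a b <-.
by rewrite -cutZ; apply: eq_cut => c d <-.
Qed.

(** The letter marked in the inner bracket is the contracted index [i]. It falls in the arc of [psi]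
    or in that of [phi], whence the two families. *)
Lemma cut_glue_bracket phi psi chi w :
  cut (glue (bracket phi psi) chi) w
  = cut4 (glue_right phi psi chi) w + cut4 (glue_left phi psi chi) w.
Proof.
transitivity (
  cut (fun u v => cut (fun c d => cut (fun d1 d2 =>
         glue_right phi psi chi c d1 d2 v) d) u) w
  + cut (fun u v => cut (fun c d => cut (fun c1 c2 =>
         glue_left phi psi chi c1 c2 d v) c) u) w).
  rewrite -cutD; apply: eq_cut => u v _.
  rewrite /glue; under eq_bigr => i _ do under eq_bigr => j _ do
    rewrite /bracket rotsum_cut_cons mulrDl mulrDr mulrDr.
  under eq_bigr do rewrite big_split /=.
  rewrite big_split /=; congr (_ + _).
    under eq_bigr => i _ do under eq_bigr => j _ do
      rewrite [X in _ * (_ * X)]mulrC -!cutZ.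
    under eq_bigr do rewrite -cut_sum.
    rewrite -cut_sum; apply: eq_cut => c d <-.
    under eq_bigr => i _ do under eq_bigr => j _ do
      rewrite -!cutZ.
    under eq_bigr do rewrite -cut_sum.
    rewrite -cut_sum; apply: eq_cut => d1 d2 <-.
    apply: eq_bigr => i _; apply: eq_bigr => j _.
    rewrite /glue !mulr_sumr; apply: eq_bigr => k _.
    rewrite !mulr_sumr; apply: eq_bigr => l _.
    by rewrite !sgD; ring.
  under eq_bigr => i _ do under eq_bigr => j _ do
    rewrite [X in _ * (_ * X)]mulrC -!cutZ.
  under eq_bigr do rewrite -cut_sum.
  rewrite -cut_sum; apply: eq_cut => c d <-.
  under eq_bigr => i _ do under eq_bigr => j _ do
    rewrite -!cutZ.
  under eq_bigr do rewrite -cut_sum.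
  rewrite -cut_sum; apply: eq_cut => c1 c2 <-.
  apply: eq_bigr => i _; apply: eq_bigr => j _.
  rewrite /glue !mulr_sumr; apply: eq_bigr => k _.
  rewrite !mulr_sumr; apply: eq_bigr => l _.
  by rewrite !sgD; ring.
(* Coassociativity regroups the four consecutive pieces into two pairs. *)
congr (_ + _).
  under eq_cut => u v _ do
    rewrite -(cutA (fun c d1 d2 => glue_right phi psi chi c d1 d2 v)).
  rewrite (cutA (fun a d2 v =>
    cut (fun c d1 => glue_right phi psi chi c d1 d2 v) a)).
  by apply: eq_cut => u v _; rewrite cut_cut.
rewrite (cutA (fun c d v =>
  cut (fun c1 c2 => glue_left phi psi chi c1 c2 d v) c)).
by apply: eq_cut => u v _; rewrite cut_cut.
Qed.

(** Both terms attach [phi] and [chi] to [psi] along the same four pieces. They differ by the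
    orientation of the contraction between [phi] and [psi], and the antisymmetry of [N] gives
    opposite signs. *)
Lemma glue_right_left p q r phi psi chi a b c d :
  cyclic par psi -> has_parity p phi -> has_parity q psi ->
  has_parity r chi ->
  sg (p && r) * glue_right phi psi chi a b c d
  + sg (q && p) * (sg (parity (a ++ b) && parity (c ++ d))
                   * glue_left psi chi phi c d a b) = 0.
Proof.
move=> cpsi hp hq hr; apply/eqP; rewrite addr_eq0; apply/eqP.
have -> : glue_left psi chi phi c d a b =
  \sum_i \sum_j \sum_k \sum_l N l k * N i j *
    (sg (((par l (+) parity ((c ++ d) ++ a)) && parity b)
         (+) ((par l (+) parity (c ++ d)) && parity a)
         (+) ((par i (+) parity (a ++ l :: c)) && parity d))
     * (psi (i :: a ++ l :: c) * chi (j :: d) * phi (k :: b))).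
  rewrite /glue_left.
  under eq_bigr do rewrite exchange_big /=.
  rewrite exchange_big /=; apply: eq_bigr => i _.
  under eq_bigr do rewrite exchange_big /=.
  rewrite exchange_big /=; apply: eq_bigr => j _.
  by rewrite exchange_big.
rewrite /glue_right !mulr_sumr -sumrN; apply: eq_bigr => i _.
rewrite !mulr_sumr -sumrN; apply: eq_bigr => j _.
rewrite !mulr_sumr -sumrN; apply: eq_bigr => k _.
rewrite !mulr_sumr -sumrN; apply: eq_bigr => l _.
have [eij|nij] := eqVneq (par j) (par i); last first.
  by rewrite [N i j]N_par ?(mul0r, mulr0, oppr0) // eq_sym.
have [ekl|nkl] := eqVneq (par k) (par l); last first.
  by rewrite [N k l]N_par ?[N l k]N_par ?(mul0r, mulr0, oppr0) // eq_sym.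
have [ep|np] := eqVneq (parity (k :: b)) p; last first.
  by rewrite (hp _ np) ?(mul0r, mulr0, oppr0).
have [er|nr] := eqVneq (parity (j :: d)) r; last first.
  by rewrite (hr _ nr) ?(mul0r, mulr0, oppr0).
(* Cyclicity of the middle form: its two contracted letters [i] and [l] separate the arcs [a] and
   [c], which the two families list in opposite orders. *)
rewrite [psi (i :: a ++ _)](cyclic_cat (i :: a) (l :: c) cpsi) cat_cons.
have [eq|nq] := eqVneq (parity (l :: c ++ i :: a)) q; last first.
  by rewrite (hq _ nq) ?(mul0r, mulr0, oppr0).
rewrite (N_antisym k l).
set s1 := sg _; set s2 := sg (par k); set s3 := sg _; set s4 := sg _.
set s5 := sg _; set s6 := sg _; set s7 := sg _.
have es : s1 * s2 * s3 = s4 * s5 * s6 * s7.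
  rewrite /s1 /s2 /s3 /s4 /s5 /s6 /s7 -!sgD -ep -eq -er; congr (sg _).
  rewrite !(parity_cat, parity_cons) eij ekl.
  by parity_cases par.
transitivity (- (s1 * s2 * s3 * (N i j * N l k *
   (phi (k :: b) * psi (l :: c ++ i :: a) * chi (j :: d))))).
  by ring.
by rewrite es; ring.
Qed.

Lemma bracket_jacobi p q r phi psi chi w :
  cyclic par phi -> cyclic par psi -> cyclic par chi ->
  has_parity p phi -> has_parity q psi -> has_parity r chi ->
  sg (p && r) * bracket (bracket phi psi) chi w
  + sg (q && p) * bracket (bracket psi chi) phi w
  + sg (r && q) * bracket (bracket chi phi) psi w = 0.
Proof.
move=> c1 c2 c3 h1 h2 h3.
have cancel s t r' f g h : cyclic par g -> has_parity s f ->
    has_parity t g -> has_parity r' h ->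
    sg (s && r') * rotsum (cut4 (glue_right f g h)) w
    + sg (t && s) * rotsum (cut4 (glue_left g h f)) w = 0.
  move=> cg hf hg hh; rewrite [X in _ + _ * X]rotsum_cut4C -!rotsumZ -rotsumD.
  rewrite rotsumE big1 // => k _; rewrite -!cut4Z -cut4D.
  rewrite /cut4 (_ : cut _ _ = 0) ?mulr0 // -[RHS](cut0 K (rot k w)).
  apply: eq_cut => u v _; rewrite -[RHS](cut0 K u); apply: eq_cut => a b _.
  rewrite -[RHS](cut0 K v); apply: eq_cut => x y _.
  exact: glue_right_left.
have split f g h : bracket (bracket f g) h w =
    rotsum (cut4 (glue_right f g h)) w + rotsum (cut4 (glue_left f g h)) w.
  by rewrite -rotsumD; apply: eq_rotsum => v; rewrite cut_glue_bracket.
rewrite !split !mulrDr.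
have := cancel _ _ _ _ _ _ c2 h1 h2 h3.
have := cancel _ _ _ _ _ _ c3 h2 h3 h1.
have := cancel _ _ _ _ _ _ c1 h3 h1 h2.
move=> e1 e2 e3.
have := congr2 +%R (congr2 +%R e1 e2) e3; rewrite !addr0 => <-.
by ring.
Qed.

End Bracket.

(** * Brackets of linear forms with cyclized tensor products *)

Section Tensors.
Variables (K : comNzRingType) (I : finType) (par : I -> bool).
Variable N : I -> I -> K.
Hypothesis N_par : forall i j, par i != par j -> N i j = 0.
Implicit Types (a c w : seq I) (bs : seq (bool * (I -> K))).

Local Notation parity := (word_parity par).
Local Notation sg := (sg K).
Local Notation rotsum := (rotsum par).

Local Notation parities := (word_parity fst).

Fixpoint tens bs w : K :=
  match bs, w with
  | [::], [::] => 1
  | b :: bs', i :: w' => sg (parities bs' && par i) * b.2 i * tens bs' w'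
  | _, _ => 0
  end.

Definition homogeneous (b : bool * (I -> K)) : Prop :=
  forall i, par i != b.1 -> b.2 i = 0.

Lemma tens_size bs w : size bs != size w -> tens bs w = 0.
Proof.
elim: bs w => [|b bs IHbs] [|i w] //= ne; rewrite IHbs ?mulr0 //.
Qed.

Lemma tens_cat bs bs' a c : size a = size bs ->
  tens (bs ++ bs') (a ++ c) =
  sg (parities bs' && parity a) * tens bs a * tens bs' c.
Proof.
elim: bs a => [|b bs IHbs] [|i a] //=; first by rewrite andbF !mul1r.
case=> /IHbs->; rewrite parity_cat.
rewrite andb_addl andb_addr !sgD; ring.
Qed.

Lemma tens_parity bs w :
  (forall t, (t < size bs)%N -> homogeneous (nth (false, fun=> 0) bs t)) ->
  parity w != parities bs -> tens bs w = 0.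
Proof.
elim: bs w => [|b bs IHbs] [|i w] //= hom ne.
have [eqi|nei] := eqVneq (par i) b.1; last first.
  by rewrite (hom 0%N) ?mulr0 ?mul0r.
rewrite IHbs ?mulr0 //; first by move=> t lt; apply: (hom t.+1).
by apply: contra ne => /eqP->; rewrite eqi.
Qed.

Lemma tens_mid bs b bs' a j c : size a = size bs ->
  tens (bs ++ b :: bs') (a ++ j :: c) =
  sg ((b.1 && parity a) (+) (parities bs' && par j)) * b.2 j
  * tens (bs ++ bs') (a ++ c).
Proof.
move=> sz; rewrite !tens_cat //= andb_addl !sgD; ring.
Qed.

Lemma bracket_tens (alpha phi : seq I -> K) bs w :
  (forall v, size v != 1 -> alpha v = 0) ->
  (forall t, (t < size bs)%N -> homogeneous (nth (false, fun=> 0) bs t)) ->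
  phi =1 rotsum (tens bs) ->
  bracket par N alpha phi w =
  \sum_(t < size bs) let b := nth (false, fun=> 0) bs t in
    sg (b.1 && parities (take t bs))
    * (\sum_i \sum_j N i j * (alpha [:: i] * b.2 j))
    * rotsum (tens (take t bs ++ drop t.+1 bs)) w.
Proof.
move=> alpha1 hom ephi.
(* A linear form receives only its contracted letter, so the cut is at the start of the word; in
   [E], the rotated tensor product reads [j] between [d] and [c]. *)
pose E c d := \sum_i \sum_j N i j * (sg (par i && parity (c ++ d)) *
  (alpha [:: i] * (sg ((par j (+) parity c) && parity d)
                   * tens bs (d ++ j :: c)))).
transitivity (rotsum (cut E) w).
  apply: eq_rotsum => v; transitivity (glue par N alpha phi [::] v).
    case: v => // x v; rewrite /= -[RHS]addr0; congr (_ + _).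
    rewrite -[RHS](cut0 K v); apply: eq_cut => a b _.
    rewrite /glue big1 // => i _; rewrite big1 // => j _.
    by rewrite alpha1 ?(mul0r, mulr0).
  rewrite /glue; transitivity (\sum_i \sum_j cut (fun c d =>
      N i j * (sg (par i && parity (c ++ d)) *
      (alpha [:: i] * (sg ((par j (+) parity c) && parity d)
                   * tens bs (d ++ j :: c))))) v).
    apply: eq_bigr => i _; apply: eq_bigr => j _.
    rewrite ephi /= -!cutZ; apply: eq_cut => c d <-.
    by rewrite /= addbF.
  by under eq_bigr do rewrite -cut_sum; rewrite -cut_sum.
(* Once the arcs are exchanged, the first piece is read by the factors that precede the one
   receiving [j]: cut positions become indices of factors. *)
rewrite rotsum_cutC; under [RHS]eq_bigr do rewrite /= -rotsumZ.
rewrite -rotsum_sum; apply: eq_rotsum => {}w.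
(* The contraction removes one factor, so for any other length of [w] both sides vanish. *)
have [sz|sz] := eqVneq (size bs) (size w).+1; last first.
  rewrite -[LHS]/(cut _ w) big1 => [|t _].
    rewrite -[RHS](cut0 K w); apply: eq_cut => a b eqw.
    rewrite /E big1 ?mulr0 // => i _; rewrite big1 // => j _.
    rewrite tens_size ?(mulr0, mul0r) //; apply: contra sz => /eqP->.
    by rewrite -eqw !size_cat /= addnS.
  rewrite tens_size ?mulr0 //; apply: contra sz => /eqP <-.
  rewrite size_cat size_take ltn_ord size_drop -addnS -subSn ?ltnS //.
  by rewrite subSS subnKC // ltnW.
rewrite cutE sz; apply: eq_bigr => t _ /=.
set a := take t w; set c := drop t w.
have lt_t : (t < size bs)%N by rewrite sz.
set b := nth _ bs t.
have sza : size a = size (take t bs).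
  by have := ltn_ord t; rewrite !size_take_min sz; lia.
rewrite /E !mulr_sumr mulr_suml; apply: eq_bigr => i _.
rewrite !mulr_sumr mulr_suml; apply: eq_bigr => j _.
have [eij|nij] := eqVneq (par i) (par j); last first.
  by rewrite N_par // ?(mulr0, mul0r).
have [ejb|njb] := eqVneq (par j) b.1; last first.
  have b0 : b.2 j = 0 by apply: hom.
  rewrite -[X in tens X (a ++ j :: c)](cat_take_drop t bs).
rewrite (drop_nth (false, fun=> 0) lt_t) -/b.
  by rewrite tens_mid // b0 !(mulr0, mul0r).
rewrite -[X in tens X (a ++ j :: c)](cat_take_drop t bs).
rewrite (drop_nth (false, fun=> 0) lt_t) -/b.
rewrite -[X in _ = _ * tens _ X](cat_take_drop t w) -/a -/c.
rewrite tens_mid // tens_cat //.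
have homt t' : (t' < size (take t bs))%N ->
    homogeneous (nth (false, fun=> 0) (take t bs) t').
  rewrite size_take_min leq_min => /andP[lt1 lt2].
  by rewrite nth_take //; apply: hom.
have homd t' : (t' < size (drop t.+1 bs))%N ->
    homogeneous (nth (false, fun=> 0) (drop t.+1 bs) t').
  rewrite size_drop nth_drop => lt1; apply: hom; lia.
have [ea|na] := eqVneq (parity a) (parities (take t bs)); last first.
  by rewrite (tens_parity homt na) !(mul0r, mulr0).
have [ec|nc] := eqVneq (parity c) (parities (drop t.+1 bs)); last first.
  by rewrite (tens_parity homd nc) !(mul0r, mulr0).
set s1 := sg _; set s2 := sg _; set s3 := sg _; set s4 := sg _.
set s5 := sg _; set s6 := sg _.
have es : s1 * s2 * s3 * s4 = s6.
  rewrite /s1 /s2 /s3 /s4 /s6 -!sgD; congr (sg _).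
  by rewrite parity_cat -ea -ec eij ejb; parity_cases par.
transitivity (s1 * s2 * s3 * s4 * (N i j * (alpha [:: i] * (b.2 j)) *
   (s5 * tens (take t bs) a * tens (drop t.+1 bs) c))); first by ring.
by rewrite es; ring.
Qed.

End Tensors.

(** * Homogeneous bases *)

Definition oddz (z : int) : bool := odd `|z|%N.

Lemma oddzD x y : oddz (x + y) = oddz x (+) oddz y.
Proof. rewrite /oddz; lia. Qed.

Lemma oddzN x : oddz (- x) = oddz x.
Proof. by rewrite /oddz abszN. Qed.

Lemma oddzM x y : oddz (x * y) = oddz x && oddz y.
Proof. by rewrite /oddz abszM oddM. Qed.

Lemma expN1z (K : fieldType) (z : int) : (-1) ^ z = sg K (oddz z).
Proof.
case: z => k; rewrite /oddz /sg /exprz; first by rewrite signr_odd.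
by rewrite invr_sign signr_odd.
Qed.

Lemma linear_at0 (K : fieldType) (U W : lmodType K) (h : U -> W) :
  linear h -> h 0 = 0.
Proof. by move/(_ (-1) 0 0); rewrite !scaleN1r oppr0 addr0 addNr. Qed.

Lemma linear_combination (K : fieldType) (U W : lmodType K) (h : U -> W)
    (J : Type) (r : seq J) (a : J -> K) (x : J -> U) : linear h ->
  h (\sum_(j <- r) a j *: x j) = \sum_(j <- r) a j *: h (x j).
Proof.
move=> hL; elim: r => [|j r IHr]; last by rewrite !big_cons hL IHr.
by rewrite !big_nil linear_at0.
Qed.

Section HomogeneousBasis.
Variables (K : fieldType) (V : vectType K) (G : grading V).

Lemma gradingP_ord : exists m (k : 'I_m -> int),
  [/\ injective k, directv (\sum_(i < m) G (k i)),
      (\sum_(i < m) G (k i))%VS = fullv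
    & forall z, (forall i, k i != z) -> G z = 0%VS].
Proof.
have [s [us G0 dG fG]] := gradingP G.
exists (size s), (fun i => s`_i); split.
- move=> i j /eqP; rewrite nth_uniq // => /eqP; exact: val_inj.
- apply/directvP; have /directvP := dG; rewrite /= => dG'.
  have sE : (\sum_(i < size s) G s`_i = \sum_(i <- s) G i)%VS.
    by rewrite [RHS](big_nth 0) big_mkord.
  by rewrite sE dG' [LHS](big_nth 0) big_mkord.
- by rewrite -fG (big_nth 0) big_mkord.
move=> z zk; apply: G0; apply/negP => /(nthP 0)[i lti eqz].
by have := zk (Ordinal lti); rewrite /= eqz eqxx.
Qed.

Lemma homogeneous_basis : exists n (d : n.-tuple int) (e : n.-tuple V),
  basis_of fullv e /\ forall i, tnth e i \in G (tnth d i).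
Proof.
have [m [k [_ dG fG _]]] := gradingP_ord.
pose X := \big[cat/[::]]_(i < m) (vbasis (G (k i)) : seq V).
have XB : basis_of fullv X.
  by rewrite -fG; apply: bigcat_basis => // i _; apply: vbasisP.
have XG (x : V) : x \in X -> exists z, x \in G z.
  rewrite /X; elim/big_rec: _ => // i Y _ IHY; rewrite mem_cat => /orP[xG|//].
  by exists (k i); apply: vbasis_mem.
have /fin_all_exists[d dP] (i : 'I_(size X)) :
    exists z, tnth (in_tuple X) i \in G z.
  by apply: XG; apply: mem_tnth.
exists (size X), [tuple d i | i < size X], (in_tuple X); split=> // i.
by rewrite tnth_mktuple.
Qed.

Section Coordinates.
Variables (n : nat) (d : n.-tuple int) (e : n.-tuple V).
Hypothesis eB : basis_of fullv e.
Hypothesis eG : forall i, tnth e i \in G (tnth d i).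

Lemma coord_sum x : x = \sum_(i < n) coord e i x *: tnth e i.
Proof.
rewrite {1}(coord_basis eB (memvf x)).
by apply: eq_bigr => i _; rewrite (tnth_nth 0).
Qed.

Lemma coord_tnth i j : coord e j (tnth e i) = (i == j)%:R.
Proof. by rewrite (tnth_nth 0) coord_free // (basis_free eB). Qed.

Lemma coord_homogeneous x z i : x \in G z -> tnth d i != z -> coord e i x = 0.
Proof.
have [m [k [kI dG fG G0]]] := gradingP_ord.
move=> xG diz.
(* The part of degree [k j] of the expansion of [x], minus the part of that degree of [x] itself.
   These differences sum to 0, so directness of the grading kills each of them. *)
pose us j : V := (\sum_(i | tnth d i == k j) coord e i x *: tnth e i)
                 - (if z == k j then x else 0).
have us0 j : us j = 0.
  have /directv_sum_independent indep := dG.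
  apply: (indep us) => // [{}j _|].
    rewrite memvB //; last by case: eqP => [<-|_] //; apply: mem0v.
    by apply: memv_suml => l /eqP dl; rewrite memvZ // -dl.
  rewrite sumrB; apply/eqP; rewrite subr_eq0; apply/eqP.
  have once (y : V) z' : y \in G z' ->
      \sum_(j < m) (if z' == k j then y else 0) = y.
    move=> yG; have [/existsP[l /eqP kl]|/existsPn nk] :=
        boolP [exists l, k l == z'].
      rewrite (bigD1 l) //= kl eqxx big1 ?addr0 // => l' nl.
      by rewrite -kl eq_sym (inj_eq kI) (negPf nl).
    move: yG; rewrite G0 // memv0 => /eqP->.
    by rewrite big1 // => l _; case: ifP.
  rewrite (once _ _ xG) {2}(coord_sum x).
  under eq_bigr do rewrite big_mkcond /=.
  rewrite exchange_big; apply: eq_bigr => l _.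
  by rewrite (once _ (tnth d l)) // memvZ.
(* If the degree of [e_i] is not listed, its component is 0 and [e_i] would vanish, which a basis
   vector does not. *)
have [/existsP[j /eqP kj]|/existsPn nk] := boolP [exists j, k j == tnth d i].
  have := us0 j; rewrite /us kj [z == _]eq_sym (negPf diz) subr0.
  rewrite big_mkcond /=.
  have -> : \sum_i0 (if tnth d i0 == tnth d i then coord e i0 x *: tnth e i0
                     else 0) =
    \sum_(i0 < n) (if tnth d i0 == tnth d i then coord e i0 x else 0) *: e`_i0.
    apply: eq_bigr => l _; rewrite -tnth_nth; case: ifP => //.
    by rewrite scale0r.
  move=> s0; have /freeP/(_ _ s0 i) := basis_free eB.
  by rewrite eqxx.
have ei0 : tnth e i = 0.
  by apply/eqP; rewrite -memv0 -(G0 (tnth d i)) // => l; apply: nk.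
have := coord_tnth i i; rewrite ei0 linear0 eqxx => /esym/eqP.
by rewrite oner_eq0.
Qed.

Let letter i : int * V := (tnth d i, tnth e i).

Definition basis_word (J : seq 'I_n) : seq (int * V) := map letter J.

Definition basis_vectors (J : seq 'I_n) : seq V := map (tnth e) J.

Lemma unzip2_basis_word J : unzip2 (basis_word J) = basis_vectors J.
Proof. by rewrite /unzip2 -map_comp. Qed.

Lemma basis_word_homword J : homword G (basis_word J).
Proof. by apply/allP => p /mapP[i _ ->] /=. Qed.

(** The recorded degree [z] is held fixed while the vector varies, so that expressions with Koszul
    signs qualify. *)
Definition letterwise_linear (F : seq (int * V) -> K^o) : Prop :=
  forall s t z, linear (fun x => F (s ++ (z, x) :: t)).

(** A homogeneous vector of degree [z] expands over basis vectors of degree [z], so expanding a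
    letter keeps its recorded degree and yields basis letters. *)
Lemma letterwise_linear_eq F F' w :
  letterwise_linear F -> letterwise_linear F' ->
  (forall J, F (basis_word J) = F' (basis_word J)) ->
  homword G w -> F w = F' w.
Proof.
move=> lF lF' eqF hw.
(* Letters are expanded from left to right; [J] is the prefix already expanded. *)
suff: forall J, F (basis_word J ++ w) = F' (basis_word J ++ w) by move/(_ [::]).
elim: w hw => [_|[z x] w IHw /andP[/= xG hw]] J; first by rewrite !cats0.
rewrite (coord_sum x) !(linear_combination _ _ _ (lF _ _ _)).
rewrite (linear_combination _ _ _ (lF' _ _ _)); apply: eq_bigr => i _.
have [diz|/(coord_homogeneous xG)->] := eqVneq (tnth d i) z; last first.
  by rewrite !scale0r.
congr (_ *: _); rewrite -diz -!cat_rcons -[(_, _)]/(letter i) -!map_rcons.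
exact: IHw.
Qed.

Fixpoint extend (phi : seq 'I_n -> K) (s : seq V) : K^o :=
  if s is x :: s' then \sum_i coord e i x *: extend (fun J => phi (i :: J)) s'
  else phi [::].

Lemma extend_multilinear phi : multilinear (extend phi).
Proof.
move=> s t a x y; elim: s phi => [|x' s IHs] phi /=.
  rewrite scaler_sumr -big_split; apply: eq_bigr => i _ /=.
  by rewrite linearP scalerDl scalerA.
rewrite scaler_sumr -big_split; apply: eq_bigr => i _ /=.
by rewrite IHs scalerDr !scalerA mulrC.
Qed.

Lemma extend_basis phi J : extend phi (basis_vectors J) = phi J.
Proof.
elim: J phi => //= i J IHJ phi; rewrite (bigD1 i) //= IHJ coord_tnth eqxx.
rewrite scale1r big1 ?addr0 // => j nij.
by rewrite coord_tnth eq_sym (negPf nij) scale0r.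
Qed.

Lemma multilinear_extend (F : seq V -> K^o) s :
  multilinear F -> F s = extend (fun J => F (basis_vectors J)) s.
Proof.
elim: s F => //= x s IHs F lF; rewrite {1}(coord_sum x).
rewrite (linear_combination _ _ _ (lF [::] s)); apply: eq_bigr => i _ /=.
congr (_ *: _); apply: (IHs (fun s => F (tnth e i :: s))) => s1.
exact: lF (_ :: s1).
Qed.

Lemma multilinear_eq (F F' : seq V -> K^o) :
  multilinear F -> multilinear F' ->
  (forall J, F (basis_vectors J) = F' (basis_vectors J)) -> F = F'.
Proof.
move=> lF lF' eqF; apply/funext => s.
rewrite (multilinear_extend s lF) (multilinear_extend s lF').
by congr (extend _ s); apply/funext.
Qed.

Lemma multilinear_letterwise F : multilinear F ->
  letterwise_linear (fun w => F (unzip2 w)).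
Proof.
by move=> lF s t z a x y; rewrite /unzip2 !map_cat /= lF.
Qed.

Lemma letterwise_scale (S : seq int -> K) F : letterwise_linear F ->
  letterwise_linear (fun w => S (unzip1 w) * F w).
Proof.
move=> lF s t z a x y; rewrite /unzip1 !map_cat /= lF mulrDr.
by rewrite [in RHS]/GRing.scale /= mulrCA.
Qed.

Lemma letterwise_sum (J : Type) (r : seq J) F :
  (forall j, letterwise_linear (F j)) ->
  letterwise_linear (fun w => \sum_(j <- r) F j w).
Proof.
move=> lF s t z a x y; rewrite scaler_sumr -big_split.
by apply: eq_bigr => j _; rewrite lF.
Qed.

Definition basis_par (i : 'I_n) : bool := oddz (tnth d i - 1).

Lemma wdeg_cons (p : int * V) w : wdeg (p :: w) = p.1 - 1 + wdeg w.
Proof. by rewrite /wdeg big_cons. Qed.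

Lemma wdeg_cat (u v : seq (int * V)) : wdeg (u ++ v) = wdeg u + wdeg v.
Proof. by rewrite /wdeg big_cat. Qed.

Lemma oddz_wdeg J : oddz (wdeg (basis_word J)) = word_parity basis_par J.
Proof.
elim: J => [|i J IHJ]; first by rewrite /wdeg big_nil.
by rewrite /= wdeg_cons oddzD IHJ.
Qed.

Lemma cycl_basis F J :
  cycl F (basis_word J) = rotsum basis_par (fun J => F (basis_word J)) J.
Proof.
rewrite rotsumE /cycl size_map; apply: eq_bigr => r _.
by rewrite -map_take -map_drop -map_rot expN1z oddzM !oddz_wdeg.
Qed.

Lemma cycl_letterwise F : letterwise_linear F -> letterwise_linear (cycl F).
Proof.
move=> lF.
(* The signs depend on the degrees and the number of rotations on the length; neither changes
   between the three words to be compared. *)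
pose S m r (ds : seq int) : K := (r < maxn 1 m)%:R *
  (-1) ^ ((\sum_(c <- take r ds) (c - 1)) * (\sum_(c <- drop r ds) (c - 1))).
have cyclE w m : size w = m -> cycl F w =
    \sum_(r < maxn 1 m) S m r (unzip1 w) * F (rot r w).
  move=> <-; apply: eq_bigr => r _; rewrite /S ltn_ord mul1r.
  by rewrite /unzip1 -map_take -map_drop /wdeg !big_map.
move=> s t z a x y; pose m := size (s ++ (z, x) :: t).
have sz y' : size (s ++ (z, y') :: t) = m by rewrite /m !size_cat.
rewrite !(cyclE _ m) //.
have lR r : letterwise_linear (fun w => F (rot r w)).
  move=> s' t' z' a' x' y'; rewrite /rot.
  rewrite !drop_cat !take_cat; case: ltnP => _.
    by rewrite -!catA !cat_cons lF.
  case: (r - size s')%N => [|k] /=; first exact: (lF [::]).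
  by rewrite !catA lF.
have lS r := @letterwise_scale (S m r) _ (lR r).
exact: (@letterwise_sum _ _ _ (fun r => lS _)).
Qed.

End Coordinates.
End HomogeneousBasis.

(** * Cyclic forms in coordinates *)

Section Cforms.
Variables (K : fieldType) (V : vectType K) (G : grading V).
Variables (n : nat) (d : n.-tuple int) (e : n.-tuple V).
Hypothesis eB : basis_of fullv e.
Hypothesis eG : forall i, tnth e i \in G (tnth d i).
Implicit Types (f g : cform G).

Local Notation par := (basis_par d).
Local Notation ev := (basis_vectors e).

Lemma cform_multilinear f : multilinear f.
Proof. by case: f => F /= /asboolP[]. Qed.

Lemma cform_koszul f : koszul_cyclic G f.
Proof. by case: f => F /= /asboolP[]. Qed.

Lemma cform_basis_cyclic f : cyclic par (fun J => f (ev J)).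
Proof.
move=> i J.
have hw : homword G (rcons (basis_word d e J) (tnth d i, tnth e i)).
  by rewrite -(map_rcons _ J i); apply: basis_word_homword.
have := cform_koszul f hw.
by rewrite unzip2_basis_word expN1z oddzM oddz_wdeg -map_rcons.
Qed.

Lemma cform_eq f g : (forall J, f (ev J) = g (ev J)) -> f = g.
Proof.
move=> fg; apply: val_inj; apply: (multilinear_eq eB) => //;
  exact: cform_multilinear.
Qed.

Lemma extend_koszul phi : cyclic par phi -> koszul_cyclic G (extend e phi).
Proof.
move=> cphi w z x hw.
(* The right-hand side as a function of the whole word, its first letter being sent to the end. The
   value at the empty word is chosen to agree with [extend e phi]. *)
pose F (w : seq (int * V)) : K^o :=
  if w is p :: w' then (-1) ^ ((p.1 - 1) * wdeg w')
     * extend e phi (rcons (unzip2 w') p.2) else phi [::].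
rewrite -[RHS]/(F ((z, x) :: w)) -[LHS]/(extend e phi (unzip2 ((z, x) :: w))).
apply: (letterwise_linear_eq eB eG (F := fun w => extend e phi (unzip2 w))).
- by apply: multilinear_letterwise; apply: extend_multilinear.
- move=> [|p s] t z' a y y'; rewrite /F /=.
    by rewrite -!cats1 extend_multilinear mulrDr scalerAr.
  rewrite /unzip2 !map_cat /= !rcons_cat /=.
  rewrite extend_multilinear !wdeg_cat !wdeg_cons /= mulrDr scalerAr.
  by [].
- case=> [//|i J].
  change (extend e phi (unzip2 (basis_word d e (i :: J))) =
    (-1) ^ ((tnth d i - 1) * wdeg (basis_word d e J))
    * extend e phi (rcons (unzip2 (basis_word d e J)) (tnth e i))).
  rewrite !unzip2_basis_word -map_rcons !(extend_basis eB) cphi.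
  by rewrite expN1z oddzM oddz_wdeg.
by move: hw; rewrite /homword all_rcons.
Qed.

Definition cform_of phi (cphi : cyclic par phi) : cform G :=
  @CForm _ _ G (extend e phi)
    (asboolT (conj (@extend_multilinear _ _ _ e phi) (extend_koszul cphi))).

Lemma cform_of_basis phi (cphi : cyclic par phi) J :
  cform_of cphi (ev J) = phi J.
Proof. exact: extend_basis. Qed.

Lemma cform_size0 f s m :
  (forall J, size J = m -> f (ev J) = 0) -> size s = m -> f s = 0.
Proof.
move=> f0 sz; rewrite (multilinear_extend eB s (cform_multilinear f)).
set F := fun J => _; have : forall J, size J = m -> F J = 0 by [].
elim: s m sz F {f0} => [|x s IHs] m /= <- F F0; first exact: F0.
rewrite big1 // => i _; rewrite (IHs (size s)) ?scaler0 // => J szJ.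
by apply: F0; rewrite /= szJ.
Qed.

Lemma has_degree_basis p f :
  has_degree p f <-> forall J, wdeg (basis_word d e J) != - p -> f (ev J) = 0.
Proof.
split=> [fp J|f0 w hw].
  apply: contraNeq => fJ; apply/eqP; apply: (fp _ (basis_word_homword eG J)).
  by rewrite unzip2_basis_word.
apply: contraNeq => wp; apply/eqP.
(* The indicator of total degree [- p]. It depends on degrees only, so [S] times [f] is letterwise
   linear and can be compared with [f] on basis words. *)
pose S (ds : seq int) : K := (\sum_(c <- ds) (c - 1) == - p)%:R.
have SE (w' : seq (int * V)) : S (unzip1 w') = (wdeg w' == - p)%:R.
  by rewrite /S /wdeg big_map.
transitivity (S (unzip1 w) * f (unzip2 w)); last by rewrite SE (negPf wp) mul0r.
have lf := multilinear_letterwise (cform_multilinear f).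
apply: (letterwise_linear_eq eB eG lf (letterwise_scale S lf)) hw => J.
rewrite SE unzip2_basis_word; have [_|/f0->] := eqVneq (wdeg _) _.
  by rewrite mul1r.
by rewrite mulr0.
Qed.

Lemma has_degree_parity p f :
  has_degree p f -> has_parity par (oddz p) (fun J => f (ev J)).
Proof.
move/has_degree_basis => fp J nJ; apply: fp; apply: contra nJ => /eqP wJ.
by rewrite -(oddz_wdeg d e) wJ oddzN.
Qed.

End Cforms.

(** * Dual bases, copairing and the bracket of a quadratic form *)

Section DualBasis.
Variables (K : fieldType) (V : vectType K) (G : grading V).
Variable b : V -> V -> K^o.
Hypothesis bQ : quadratic_form G b.

Lemma form_linearl y : linear (b^~ y).
Proof. by case: bQ => [[]]. Qed.

Lemma form_linearr x : linear (b x).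
Proof. by case: bQ => [[]]. Qed.

Lemma form_degree z z' x y :
  x \in G z -> y \in G z' -> z + z' != 0 -> b x y = 0.
Proof.
move=> xG yG; apply: contraNeq => bxy; apply/eqP.
by case: bQ => _ deg _ _; apply: deg bxy.
Qed.

(** Where [b] is not zero the degrees are opposite, hence of equal parity, and the sign (-1)^(ij) is
    (-1)^i. *)
Lemma form_sym z z' x y :
  x \in G z -> y \in G z' -> b y x = sg K (oddz z) * b x y.
Proof.
move=> xG yG; have [zz|nz] := eqVneq (z + z') 0; last first.
  by rewrite (form_degree xG yG) // (form_degree yG xG) ?mulr0 // addrC.
case: bQ => _ _ sym _; rewrite (sym _ _ _ _ xG yG) expN1z oddzM.
have /(congr1 oddz) := zz; rewrite oddzD.
by case: (oddz z); case: (oddz z').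
Qed.

Section OneBasis.
Variables (n : nat) (d : n.-tuple int) (e : n.-tuple V).
Hypothesis eB : basis_of fullv e.
Hypothesis eG : forall i, tnth e i \in G (tnth d i).

Local Notation par := (basis_par d).

Lemma form_suml x y : b x y = \sum_i coord e i x * b (tnth e i) y.
Proof.
rewrite {1}(coord_sum eB x).
exact: (linear_combination _ _ _ (form_linearl y)).
Qed.

Lemma form_sumr x y : b x y = \sum_i coord e i y * b x (tnth e i).
Proof.
rewrite {1}(coord_sum eB y).
exact: (linear_combination _ _ _ (form_linearr x)).
Qed.

Lemma form_swap i y : b y (tnth e i) = sg K (oddz (tnth d i)) * b (tnth e i) y.
Proof.
rewrite form_suml form_sumr mulr_sumr; apply: eq_bigr => j _.
by rewrite (form_sym (eG i) (eG j)) mulrCA.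
Qed.

Lemma form_nondegenerater y : (forall i, b (tnth e i) y = 0) -> y = 0.
Proof.
move=> by0; case: bQ => _ _ _; apply=> x.
by rewrite form_sumr big1 // => i _; rewrite form_swap by0 !mulr0.
Qed.

Lemma form_nondegeneratel x : (forall i, b x (tnth e i) = 0) -> x = 0.
Proof.
move=> bx0; case: bQ => _ _ _; apply=> y.
by rewrite form_sumr big1 // => i _; rewrite bx0 mulr0.
Qed.

Lemma dual_basis : exists e' : n.-tuple V,
  forall i j, b (tnth e i) (tnth e' j) = (i == j)%:R.
Proof.
pose B : 'M[K]_n := \matrix_(i, j) b (tnth e i) (tnth e j).
have uB : B \in unitmx.
  rewrite -row_free_unit -kermx_eq0; apply/eqP/row_matrixP => k.
  rewrite row0; set r := row k _.
  have rB : r *m B = 0 by apply/sub_kermxP; apply: row_sub.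
  have x0 : \sum_i r 0 i *: tnth e i = 0.
    apply: form_nondegeneratel => j; have := congr1 (fun M : 'rV_n => M 0 j) rB.
    rewrite !mxE => <-.
    rewrite (linear_combination _ _ _ (form_linearl _)); apply: eq_bigr => i _.
    by rewrite !mxE.
  apply/rowP => i; rewrite [RHS]mxE.
  have /freeP/(_ (fun i => r 0 i)) := basis_free eB; apply.
  by rewrite -[RHS]x0; apply: eq_bigr => l _; rewrite (tnth_nth 0).
exists [tuple \sum_k invmx B k j *: tnth e k | j < n] => i j.
rewrite tnth_mktuple (linear_combination _ _ _ (form_linearr _)).
have := congr1 (fun M : 'M_n => M i j) (mulmxV uB); rewrite !mxE => <-.
by apply: eq_bigr => k _; rewrite !mxE mulrC.
Qed.

Variable e' : n.-tuple V.
Hypothesis e'D : forall i j, b (tnth e i) (tnth e' j) = (i == j)%:R.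

Lemma coord_dual x j : coord e j x = b x (tnth e' j).
Proof.
rewrite form_suml (bigD1 j) //= e'D eqxx mulr1 big1 ?addr0 // => i nij.
by rewrite e'D (negPf nij) mulr0.
Qed.

Lemma dual_sum y : y = \sum_j b (tnth e j) y *: tnth e' j.
Proof.
apply/eqP; rewrite -subr_eq0; apply/eqP; apply: form_nondegenerater => i.
rewrite addrC -scaleN1r form_linearr.
rewrite (linear_combination _ _ _ (form_linearr _)) (bigD1 i) //=.
rewrite e'D eqxx big1 => [|j nij].
  by rewrite addr0 scaleN1r -[_ *: _]/(_ * 1) mulr1 addNr.
by rewrite e'D eq_sym (negPf nij) scaler0.
Qed.

Lemma dual_homogeneous i : tnth e' i \in G (- tnth d i).
Proof.
(* The component of [e'_i] of the expected degree. The difference pairs to 0 with each [e_k]: for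
   degree reasons if [e_k] has the degree of [e_i], and otherwise because it pairs with [e_k] as
   [e'_i] does. *)
pose y := \sum_(j | tnth d j == - tnth d i) coord e j (tnth e' i) *: tnth e j.
suff -> : tnth e' i = y.
  by apply: memv_suml => j /eqP <-; apply: memvZ.
apply/eqP; rewrite -subr_eq0; apply/eqP; apply: form_nondegenerater => k.
rewrite {1}(coord_sum eB (tnth e' i)).
rewrite (bigID (fun j => tnth d j == - tnth d i)) /= -/y [y + _]addrC addrK.
rewrite big_mkcond /=.
have [dki|nki] := eqVneq (tnth d k) (tnth d i).
  rewrite (eq_bigr (fun j => (if tnth d j == - tnth d i then 0
    else coord e j (tnth e' i)) *: tnth e j)); last first.
    by move=> j _; case: eqP; rewrite //= scale0r.
  rewrite (linear_combination _ _ _ (form_linearr _)) big1 // => j _.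
  case: eqP => [_|ndj]; first by rewrite scale0r.
  rewrite (form_degree (eG k) (eG j)) ?scaler0 // dki addrC addr_eq0.
  exact/eqP.
rewrite (eq_bigr (fun j => (if tnth d j == - tnth d i then 0
    else coord e j (tnth e' i)) *: tnth e j)); last first.
  by move=> j _; case: eqP; rewrite //= scale0r.
rewrite (linear_combination _ _ _ (form_linearr _)).
have : b (tnth e k) (tnth e' i) = 0.
  by rewrite e'D; case: eqP => // eki; rewrite eki eqxx in nki.
rewrite form_sumr => bki; rewrite -[RHS]bki; apply: eq_bigr => j _.
case: eqP => // dj; rewrite scale0r (form_degree (eG k) (eG j)) ?mulr0 //.
by rewrite dj subr_eq0.
Qed.

(** With [ei], [u], [v] for the parities, the sign of [contraction] reduces modulo 2 to ei + (ei +
    u) v: the first summand is put here, the second one is the sign of [glue]. *)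
Definition copairing i j : K :=
  sg K (par i) * b (tnth e' i) (tnth e' j).

Lemma copairing_degree i j : tnth d i + tnth d j != 0 -> copairing i j = 0.
Proof.
move=> dij; rewrite /copairing.
rewrite (form_degree (dual_homogeneous i) (dual_homogeneous j)) ?mulr0 //.
by rewrite -opprD oppr_eq0.
Qed.

Lemma copairing_par i j : par i != par j -> copairing i j = 0.
Proof.
move=> nij; apply: copairing_degree; apply: contra nij.
rewrite addr_eq0 /basis_par => /eqP->.
by rewrite -oddzN opprD opprK !oddzD oddzN.
Qed.

(** The symmetry sign of [b] uses degrees in V, while [par] uses degrees in V[1]. The two parities
    differ by 1, whence the minus sign. *)
Lemma copairing_antisym i j :
  copairing i j = - (sg K (par i) * copairing j i).
Proof.
have [pij|nij] := eqVneq (par i) (par j); last first.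
  by rewrite !copairing_par ?mulr0 ?oppr0 // eq_sym.
rewrite /copairing (form_sym (dual_homogeneous i) (dual_homogeneous j)).
rewrite -pij /basis_par oddzN oddzD /=.
by case: (oddz _); rewrite /sg /= ?expr0 ?expr1; ring.
Qed.

Lemma dual_coord i : tnth e' i = \sum_j b (tnth e' i) (tnth e' j) *: tnth e j.
Proof.
rewrite {1}(coord_sum eB (tnth e' i)); apply: eq_bigr => j _.
by rewrite coord_dual.
Qed.

Lemma contraction_basis (f g : cform G) J :
  contraction d e e' f g (basis_word d e J) =
  cut (glue par copairing (fun J => f (basis_vectors e J))
                          (fun J => g (basis_vectors e J))) J.
Proof.
rewrite cutE /contraction size_map; apply: eq_bigr => k _.
apply: eq_bigr => i _; rewrite -map_take -map_drop !unzip2_basis_word.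
rewrite {1}(dual_coord i).
rewrite (linear_combination _ _ _ (cform_multilinear g [::] _)) mulr_sumr.
apply: eq_bigr => j _; rewrite /copairing expN1z !(oddzD, oddzM) !oddz_wdeg.
rewrite -[oddz _ (+) oddz (-1)]oddzD -/(par i).
set u := word_parity par (take k J); set v := word_parity par (drop k J).
transitivity (sg K (par i) * sg K ((par i (+) u) && v)
  * f (basis_vectors e (i :: take k J))
  * (b (tnth e' i) (tnth e' j) * g (basis_vectors e (j :: drop k J)))).
  by rewrite -sgD; congr (sg K _ * _ * _); case: (par i); case: u; case: v.
by ring.
Qed.

Lemma contraction_letterwise (f g : cform G) :
  letterwise_linear (contraction d e e' f g).
Proof.
pose S m k i (ds : seq int) : K := (k < m.+1)%:R *
  let u := \sum_(c <- take k ds) (c - 1) in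
  let v := \sum_(c <- drop k ds) (c - 1) in
  let ei := tnth d i - 1 in (-1) ^ (ei * u + (ei + v) * (ei + u)).
pose T k i (w : seq (int * V)) : K^o :=
  f (tnth e i :: unzip2 (take k w)) * g (tnth e' i :: unzip2 (drop k w)).
have contractionE w m : size w = m -> contraction d e e' f g w =
    \sum_(k < m.+1) \sum_(i < n) S m k i (unzip1 w) * T k i w.
  move=> <-; apply: eq_bigr => k _; apply: eq_bigr => i _.
  rewrite /S ltn_ord mul1r /T mulrA.
  by rewrite /unzip1 -map_take -map_drop /wdeg !big_map.
move=> s t z a x y; pose m := size (s ++ (z, x) :: t).
have sz y' : size (s ++ (z, y') :: t) = m by rewrite /m !size_cat.
rewrite !(contractionE _ m) //.
have lT k i : letterwise_linear (T k i).
  move=> s' t' z' a' x' y'; rewrite /T /unzip2 !drop_cat !take_cat.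
  case: ltnP => _.
    rewrite !map_cat /= (cform_multilinear g (_ :: _)) mulrDr.
    by rewrite [in RHS]/GRing.scale /= mulrCA.
  case: (k - size s')%N => [|j] /=.
    rewrite !cats0 (cform_multilinear g [:: _]) mulrDr.
    by rewrite [in RHS]/GRing.scale /= mulrCA.
  rewrite !map_cat /= (cform_multilinear f (_ :: _)) mulrDl.
  by rewrite [in RHS]/GRing.scale /= mulrA.
have lS k i := @letterwise_scale _ _ (S m k i) _ (lT k i).
apply: (letterwise_sum _ (F := fun (k : 'I_m.+1) w =>
  \sum_(i < n) S m k i (unzip1 w) * T k i w)).
move=> k; apply: (letterwise_sum _ (F := fun (i : 'I_n) w =>
  S m k i (unzip1 w) * T k i w)) => i.
exact: lS.
Qed.

Definition form_bracket (f g : cform G) : cform G :=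
  cform_of eB eG (@rotsum_cyclic _ _ par
    (cut (glue par copairing (fun J => f (basis_vectors e J))
                             (fun J => g (basis_vectors e J))))).

Lemma form_bracket_basis f g J : form_bracket f g (basis_vectors e J) =
  bracket par copairing (fun J => f (basis_vectors e J))
                        (fun J => g (basis_vectors e J)) J.
Proof. exact: cform_of_basis. Qed.

Lemma form_bracket_contraction f g :
  is_cycl (form_bracket f g) (contraction d e e' f g).
Proof.
move=> w; apply: (letterwise_linear_eq eB eG
  (F := fun w => form_bracket f g (unzip2 w))).
- by apply: multilinear_letterwise; apply: cform_multilinear.
- by apply: cycl_letterwise; apply: contraction_letterwise.
move=> J; rewrite unzip2_basis_word form_bracket_basis cycl_basis.
by apply: eq_rotsum => {}J; rewrite contraction_basis.
Qed.

End OneBasis.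

(** The sum of the e_i tensor e'_i does not depend on the basis: a homogeneous change of basis is
    undone by the dual one. The signs only see the degree of [e_i], which the change preserves. *)
Lemma contraction_dual_basis n1 (d1 : n1.-tuple int) (e1 e1' : n1.-tuple V)
    n2 (d2 : n2.-tuple int) (e2 e2' : n2.-tuple V) (f g : cform G) w :
  basis_of fullv e1 -> (forall i, tnth e1 i \in G (tnth d1 i)) ->
  (forall i j, b (tnth e1 i) (tnth e1' j) = (i == j)%:R) ->
  basis_of fullv e2 -> (forall i, tnth e2 i \in G (tnth d2 i)) ->
  (forall i j, b (tnth e2 i) (tnth e2' j) = (i == j)%:R) ->
  contraction d1 e1 e1' f g w = contraction d2 e2 e2' f g w.
Proof.
move=> e1B e1G e1D e2B e2G e2D.
apply: eq_bigr => k _; set u := take k w; set v := drop k w => /=.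
pose S (z : int) : K :=
  (-1) ^ ((z - 1) * wdeg u + (z - 1 + wdeg v) * (z - 1 + wdeg u)).
transitivity (\sum_i \sum_j S (tnth d2 j) * coord e2 j (tnth e1 i)
    * f (tnth e2 j :: unzip2 u) * g (tnth e1' i :: unzip2 v)).
  apply: eq_bigr => i _; rewrite {1}(coord_sum e2B (tnth e1 i)).
  rewrite (linear_combination _ _ _ (cform_multilinear f [::] _)).
  rewrite mulr_sumr mulr_suml; apply: eq_bigr => j _.
  have [->|nij] := eqVneq (tnth d2 j) (tnth d1 i).
    by congr (_ * _); rewrite /= [in LHS]/GRing.scale /= mulrA.
  by rewrite (coord_homogeneous e2B e2G (e1G i) nij) scale0r !(mulr0, mul0r).
rewrite exchange_big; apply: eq_bigr => j _ /=.
rewrite {1}(dual_sum e1B e1G e1D (tnth e2' j)).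
rewrite (linear_combination _ _ _ (cform_multilinear g [::] _)) mulr_sumr.
apply: eq_bigr => i _; rewrite (coord_dual e2B e2D).
rewrite [in RHS]/GRing.scale /= /S; ring.
Qed.

Lemma form_bracket_of n (d : n.-tuple int) (e e' : n.-tuple V)
    (eB : basis_of fullv e) (eG : forall i, tnth e i \in G (tnth d i)) :
  (forall i j, b (tnth e i) (tnth e' j) = (i == j)%:R) ->
  bracket_of b (form_bracket eB eG e').
Proof.
move=> e'D f g n2 d2 e2 e2' e2B e2G e2D w hw.
rewrite (form_bracket_contraction eB eG e'D f g hw) /cycl.
apply: eq_bigr => r _; congr (_ * _).
exact: contraction_dual_basis.
Qed.

End DualBasis.

Section BracketSupport.
Variables (K : comNzRingType) (I : finType) (par : I -> bool).
Variable N : I -> I -> K.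

(** Arity and degree do not depend on the order of the letters, so a criterion on arcs up to
    permutation suffices for both. *)
Lemma bracket_eq0 (phi psi : seq I -> K) w :
  (forall u v i j, perm_eq (u ++ v) w ->
     N i j * (phi (i :: u) * psi (j :: v)) = 0) ->
  bracket par N phi psi w = 0.
Proof.
move=> N0; rewrite /bracket rotsumE big1 // => r _.
rewrite (_ : cut _ _ = 0) ?mulr0 // -[RHS](cut0 K (rot r w)).
apply: eq_cut => u v eqw; rewrite /glue big1 // => i _; rewrite big1 // => j _.
by rewrite mulrCA N0 ?mulr0 // eqw perm_rot.
Qed.

Lemma bracket_linearl (phi phi' psi : seq I -> K) a w :
  bracket par N (fun J => a * phi J + phi' J) psi w =
  a * bracket par N phi psi w + bracket par N phi' psi w.
Proof.
rewrite /bracket -rotsumZ -rotsumD; apply: eq_rotsum => {}w.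
rewrite -cutZ -cutD; apply: eq_cut => u v _; rewrite /glue mulr_sumr -big_split.
apply: eq_bigr => i _; rewrite mulr_sumr -big_split; apply: eq_bigr => j _ /=.
by ring.
Qed.

Lemma bracket_linearr (phi psi psi' : seq I -> K) a w :
  bracket par N phi (fun J => a * psi J + psi' J) w =
  a * bracket par N phi psi w + bracket par N phi psi' w.
Proof.
rewrite /bracket -rotsumZ -rotsumD; apply: eq_rotsum => {}w.
rewrite -cutZ -cutD; apply: eq_cut => u v _; rewrite /glue mulr_sumr -big_split.
apply: eq_bigr => i _; rewrite mulr_sumr -big_split; apply: eq_bigr => j _ /=.
by ring.
Qed.

End BracketSupport.

(** * Coordinate forms and tensor products of linear forms *)

Section Tensors.
Variables (K : fieldType) (V : vectType K) (G : grading V).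
Variables (n : nat) (d : n.-tuple int) (e : n.-tuple V).
Hypothesis eB : basis_of fullv e.
Hypothesis eG : forall i, tnth e i \in G (tnth d i).
Implicit Types (f g : cform G) (bs : seq (int * cform G)).

Local Notation par := (basis_par d).
Local Notation ev := (basis_vectors e).

Lemma tensor_letterwise bs : letterwise_linear (tensor bs).
Proof.
elim: bs => [|c bs IHbs] s t z a x y.
  by case: s => [|p s] /=; rewrite scaler0 addr0.
case: s => [|p s] /=; last by rewrite IHbs mulrDr scalerAr.
have := cform_multilinear c.2 [::] [::] a x y; rewrite /= => ->.
by rewrite mulrDr mulrDl -scalerAr -scalerAl.
Qed.

Definition basis_tensor bs :=
  [seq (oddz c.1, fun i => c.2 [:: tnth e i] : K) | c : int * cform G <- bs].

Lemma parity_basis_tensor bs :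
  word_parity fst (basis_tensor bs) = oddz (\sum_(c <- bs) c.1).
Proof.
elim: bs => [|c bs IHbs]; first by rewrite big_nil.
by rewrite big_cons oddzD -IHbs.
Qed.

Lemma tensor_basis bs J :
  tensor bs (basis_word d e J) = tens par (basis_tensor bs) J.
Proof.
elim: bs J => [|c bs IHbs] [|i J] //=.
by rewrite IHbs expN1z oddzM parity_basis_tensor.
Qed.

Lemma homogeneous_basis_tensor bs :
  {in bs, forall c, has_arity 1 c.2 /\ has_degree c.1 c.2} ->
  forall t, (t < size (basis_tensor bs))%N ->
  homogeneous par (nth (false, fun=> 0) (basis_tensor bs) t).
Proof.
move=> hom t; rewrite size_map => lt_t.
rewrite (nth_map (0, 0)) // => i ne /=.
have [_ /(has_degree_basis eB eG) deg] := hom _ (mem_nth (0, 0) lt_t).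
apply: (deg [:: i]); apply: contra ne => /eqP.
rewrite /wdeg big_seq1 /= => /(congr1 oddz); rewrite oddzN => <-.
by rewrite /basis_par.
Qed.

Lemma singleton_cyclic (i : 'I_n) : cyclic par (fun J => (J == [:: i])%:R : K).
Proof.
move=> j [|k J]; first by rewrite andbF /= mul1r.
have -> : ([:: j, k & J] == [:: i]) = false by rewrite eqseq_cons andbF.
have -> : (rcons (k :: J) j == [:: i]) = false.
  by apply/eqP => /(congr1 size); rewrite size_rcons.
by rewrite mulr0.
Qed.

Definition coordinate_form (i : 'I_n) : cform G :=
  cform_of eB eG (singleton_cyclic i).

Lemma coordinate_form_basis i J :
  coordinate_form i (ev J) = (J == [:: i])%:R.
Proof. exact: cform_of_basis. Qed.

Lemma coordinate_form_arity i : has_arity 1 (coordinate_form i).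
Proof.
move=> s sz; apply: (cform_size0 eB (m := size s)) => // J szJ.
rewrite coordinate_form_basis; case: eqP => // eJ.
by rewrite -szJ eJ in sz.
Qed.

Lemma coordinate_form_degree i :
  has_degree (1 - tnth d i) (coordinate_form i).
Proof.
apply/(has_degree_basis eB eG) => J wJ; rewrite coordinate_form_basis.
case: eqP => // eJ; move: wJ.
by rewrite eJ /wdeg big_seq1 /= opprB eqxx.
Qed.

End Tensors.

(** * The Pinczon bracket of a quadratic form *)

Section FormBracket.
Variables (K : fieldType) (V : vectType K) (G : grading V).
Variable b : V -> V -> K^o.
Hypothesis bQ : quadratic_form G b.
Variables (n : nat) (d : n.-tuple int) (e : n.-tuple V).
Hypothesis eB : basis_of fullv e.
Hypothesis eG : forall i, tnth e i \in G (tnth d i).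
Variable e' : n.-tuple V.
Hypothesis e'D : forall i j, b (tnth e i) (tnth e' j) = (i == j)%:R.
Implicit Types (f g h : cform G).

Local Notation par := (basis_par d).
Local Notation ev := (basis_vectors e).
Local Notation N := (copairing b d e').
Local Notation br := (form_bracket b eB eG e').

Lemma form_bracket_bilinear : bilinear_map br.
Proof.
split=> [g|f] a x y; apply: (cform_eq eB) => J.
  rewrite -[RHS]/(a * br x g (ev J) + br y g (ev J)) !form_bracket_basis.
  by rewrite -bracket_linearl.
rewrite -[RHS]/(a * br f x (ev J) + br f y (ev J)) !form_bracket_basis.
by rewrite -bracket_linearr.
Qed.

Lemma form_bracket_arity : arity_axiom br.
Proof.
split=> [k k' f g fk gk s sz|m f g fm].
  apply: (cform_size0 eB (m := size s)) => // J szJ; rewrite form_bracket_basis.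
  apply: bracket_eq0 => u v i j /perm_size; rewrite size_cat szJ => szuv.
  have [szu|nu] := eqVneq (size u) k.
    rewrite [g _]gk ?mulr0 //= size_map eqSS.
    by apply: contra sz => /eqP<-; rewrite -szuv szu.
  by rewrite [f _]fk ?(mul0r, mulr0) //= size_map eqSS.
split=> s sz; apply: (cform_size0 eB (m := size s)) => // J szJ;
  rewrite form_bracket_basis; apply: bracket_eq0 => u v i j /perm_size;
  rewrite size_cat szJ => szuv.
  rewrite [f _]fm ?(mul0r, mulr0) //= size_map ltnS.
  by rewrite (leq_trans _ (leqW sz)) // -szuv leq_addr.
rewrite [f _]fm ?(mul0r, mulr0) //= size_map ltnS.
by rewrite (leq_trans _ (leqW sz)) // -szuv leq_addl.
Qed.

(** A contraction joins letters with [tnth d i + tnth d j = 0], whose degrees in V[1] add up to -2;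
    the arguments left over account for the rest. *)
Lemma form_bracket_degree p q f g : has_degree p f -> has_degree q g ->
  has_degree (p + q - 2) (br f g).
Proof.
move=> /(has_degree_basis eB eG) fp /(has_degree_basis eB eG) gq.
apply/(has_degree_basis eB eG) => J wJ; rewrite form_bracket_basis.
apply: bracket_eq0 => u v i j pJ.
have [dij|nij] := eqVneq (tnth d i + tnth d j) 0; last first.
  by rewrite (copairing_degree bQ eB eG e'D nij) mul0r.
have [du|nu] := eqVneq (wdeg (basis_word d e (i :: u))) (- p); last first.
  by rewrite fp // !(mul0r, mulr0).
rewrite gq ?mulr0 //; apply: contra wJ => /eqP.
have <- : wdeg (basis_word d e (u ++ v)) = wdeg (basis_word d e J).
  by rewrite /wdeg; apply: perm_big; apply: perm_map.
move: du; rewrite /basis_word map_cat /= !wdeg_cons wdeg_cat /=; lia.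
Qed.

Lemma form_bracket_lie : graded_lie br.
Proof.
have brE f g : (fun J => br f g (ev J)) =
    bracket par N (fun J => f (ev J)) (fun J => g (ev J)).
  by apply/funext => J; rewrite form_bracket_basis.
split; first exact: form_bracket_degree.
  move=> p q f g fp gq; apply: (cform_eq eB) => J.
  rewrite -[RHS]/(- ((-1) ^ (p * q) * br g f (ev J))) !form_bracket_basis.
  rewrite expN1z oddzM; apply: bracket_antisym.
  - exact: (copairing_antisym bQ eB eG e'D).
  - exact: (copairing_par bQ eB eG e'D).
  - exact: (has_degree_parity eB eG).
  exact: (has_degree_parity eB eG).
move=> p q r f g h fp gq hr; apply: (cform_eq eB) => J.
rewrite -[LHS]/((-1) ^ (p * r) * br (br f g) h (ev J)
  + (-1) ^ (q * p) * br (br g h) f (ev J)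
  + (-1) ^ (r * q) * br (br h f) g (ev J)).
rewrite !form_bracket_basis !brE !expN1z !oddzM.
apply: bracket_jacobi; try exact: cform_basis_cyclic;
  try exact: (has_degree_parity eB eG).
  exact: (copairing_antisym bQ eB eG e'D).
exact: (copairing_par bQ eB eG e'D).
Qed.

Lemma form_bracket_derivation : derivation_axiom br.
Proof.
move=> a bs f a1 hom fbs w.
have aJ (J : seq 'I_n) : size J != 1 -> a (ev J) = 0.
  by move=> nJ; apply: a1; rewrite size_map.
pose c j : K :=
  (-1) ^ ((nth (0, 0) bs j).1 * \sum_(c <- take j bs) c.1)
  * br a (nth (0, 0) bs j).2 [::].
apply: (letterwise_linear_eq eB eG (F := fun w => br a f (unzip2 w))
  (F' := fun w => \sum_(j < size bs)
           c j * cycl (tensor (take j bs ++ drop j.+1 bs)) w)).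
- by apply: multilinear_letterwise; apply: cform_multilinear.
- apply: (letterwise_sum _ (F := fun (j : 'I_(size bs)) w =>
    c j * cycl (tensor (take j bs ++ drop j.+1 bs)) w)) => j.
  apply: (letterwise_scale (fun=> c j)).
  by apply: cycl_letterwise; apply: tensor_letterwise.
move=> J; rewrite unzip2_basis_word form_bracket_basis.
have homT := homogeneous_basis_tensor eB eG hom.
rewrite (bracket_tens _ _ aJ homT); last 2 first.
- exact: (copairing_par bQ eB eG e'D).
- move=> J'; rewrite -(unzip2_basis_word d) fbs ?basis_word_homword //.
  by rewrite cycl_basis; apply: eq_rotsum => J''; rewrite tensor_basis.
rewrite size_map; apply: eq_bigr => t _ /=.
have -> : take t (basis_tensor e bs) = basis_tensor e (take t bs).
  by rewrite /basis_tensor map_take.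
have -> : drop t.+1 (basis_tensor e bs) = basis_tensor e (drop t.+1 bs).
  by rewrite /basis_tensor map_drop.
rewrite (nth_map (0, 0)) //= [word_parity fst _]parity_basis_tensor.
rewrite /c expN1z oddzM.
congr (_ * _ * _).
  rewrite -[RHS]/(br a (nth (0, 0) bs t).2 (ev [::])) form_bracket_basis /=.
  by apply: eq_bigr => i _; apply: eq_bigr => j _; rewrite andbF mul1r.
rewrite cycl_basis; apply: eq_rotsum => J'.
by rewrite tensor_basis /basis_tensor map_cat.
Qed.

(** Up to signs, the [x i] are the coefficients of a vector [y] on the dual basis, and the
    hypothesis says that its coordinates on [e] vanish. *)
Lemma copairing_nondegenerate (x : 'I_n -> K) :
  (forall j, \sum_i N i j * x i = 0) -> forall i, x i = 0.
Proof.
move=> x0 k; pose y := \sum_i (sg K (par i) * x i) *: tnth e' i.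
have y0 : y = 0.
  rewrite (coord_sum eB y) big1 // => j _; rewrite (coord_dual bQ eB e'D).
  rewrite (linear_combination _ _ _ (form_linearl bQ _)).
  rewrite [X in X *: _](_ : _ = 0) ?scale0r // -[RHS](x0 j).
  by apply: eq_bigr => i _; rewrite /copairing -[_ *: _]/(_ * _); ring.
have : b (tnth e k) y = 0.
  by rewrite y0 (linear_at0 (form_linearr bQ _)).
rewrite (linear_combination _ _ _ (form_linearr bQ _)) (bigD1 k) //= e'D eqxx.
rewrite big1 => [|i ni]; last by rewrite e'D eq_sym (negPf ni) scaler0.
rewrite addr0 -[_ *: _]/(_ * _) mulr1 => /eqP; rewrite mulf_eq0 signr_eq0.
by move/eqP.
Qed.

(** A word of length at most 1 has a single rotation, so the bracket is one plain contraction of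
    [f]. Together with nondegeneracy, this detects the components of [f] of arity 1 and 2. *)
Lemma form_bracket_coordinate f k J : (size J <= 1)%N ->
  br f (coordinate_form eB eG k) (ev J) = \sum_i N i k * f (ev (i :: J)).
Proof.
have pair0 (phi psi : seq 'I_n -> K) w :
    (forall j u, psi (j :: u) != 0 -> u = [::]) ->
  cut (glue par N phi psi) w =
  \sum_i \sum_j N i j * (phi (i :: w) * psi [:: j]).
  move=> psi1; elim/last_ind: w => [|w x _] /=.
    by apply: eq_bigr => i _; apply: eq_bigr => j _; rewrite andbF mul1r.
  rewrite cut_rcons (_ : cut _ _ = 0) ?add0r.
    by apply: eq_bigr => i _; apply: eq_bigr => j _; rewrite andbF mul1r.
  rewrite -[RHS](cut0 K w); apply: eq_cut => u v _.
  rewrite /glue big1 // => i _; rewrite big1 // => j _.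
  have [->|/psi1] := eqVneq (psi (j :: rcons v x)) 0; first by rewrite !mulr0.
  by move/(congr1 size); rewrite size_rcons.
move=> J1; rewrite form_bracket_basis.
transitivity (cut (glue par N (fun J => f (ev J))
   (fun J => coordinate_form eB eG k (ev J))) J).
  by case: J J1 => [|j [|//]] //= _; rewrite /bracket /= ?andbF ?mul1r.
rewrite pair0 => [|j u]; last first.
  by case: u => // x u; rewrite coordinate_form_basis eqseq_cons andbF eqxx.
apply: eq_bigr => i _; rewrite (bigD1 k) // big1 => [|j nj].
  by rewrite [LHS]addr0 coordinate_form_basis eqxx mulr1.
rewrite coordinate_form_basis eqseq_cons (negPf nj) !mulr0.
by [].
Qed.

Lemma form_bracket_center : center_axiom br.
Proof.
split=> [f f0 g|f f2 f0].
  apply: (cform_eq eB) => J; rewrite form_bracket_basis.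
  by apply: bracket_eq0 => u v i j _; rewrite [f _]f0 ?(mul0r, mulr0).
have fJ J : (size J <= 1)%N -> forall i, f (ev (i :: J)) = 0.
  move=> J1; apply: copairing_nondegenerate => k.
  by rewrite -form_bracket_coordinate // f0.
move=> s s0; apply: (cform_size0 eB (m := size s)) => // -[|i J] szJ.
  by rewrite -szJ in s0.
have [J1|J2] := leqP (size J) 1; first exact: fJ.
by apply: f2; rewrite size_map.
Qed.

Lemma form_bracket_pinczon : pinczon_bracket br.
Proof.
split.
- exact: form_bracket_bilinear.
- exact: form_bracket_arity.
- exact: form_bracket_lie.
- exact: form_bracket_derivation.
exact: form_bracket_center.
Qed.

End FormBracket.

(** * Cyclic forms and coderivations *)

Section Symplectic.
Variables (K : fieldType) (V : vectType K) (G : grading V).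
Variables b B : V -> V -> K^o.
Hypothesis bQ : quadratic_form G b.
Hypothesis bB : symplectic_of G b B.
Variables (n : nat) (d : n.-tuple int) (e e' : n.-tuple V).
Hypothesis eB : basis_of fullv e.
Hypothesis eG : forall i, tnth e i \in G (tnth d i).
Hypothesis e'D : forall i j, b (tnth e i) (tnth e' j) = (i == j)%:R.

Local Notation par := (basis_par d).
Local Notation parity := (word_parity par).
Local Notation ev := (basis_vectors e).
Local Notation N := (copairing b d e').

Lemma symplecticE z x y : x \in G z -> B x y = sg K (oddz (z - 1)) * b x y.
Proof. by move=> xG; rewrite (bB.2 _ _ _ xG) expN1z. Qed.

Lemma symplectic_sum x y :
  B x y = \sum_i coord e i x * (sg K (par i) * b (tnth e i) y).
Proof.
rewrite {1}(coord_sum eB x) (linear_combination _ _ _ (bB.1.1 y)).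
by apply: eq_bigr => i _; rewrite (symplecticE _ (eG i)).
Qed.

Lemma symplectic_dual x i : B x (tnth e' i) = sg K (par i) * coord e i x.
Proof.
rewrite symplectic_sum (bigD1 i) //= e'D eqxx big1 => [|j nij].
  by rewrite addr0 mulr1 mulrC.
by rewrite e'D (negPf nij) !mulr0.
Qed.

Lemma symplectic_inj x x' : B x =1 B x' -> x = x'.
Proof.
move=> eqB; rewrite (coord_sum eB x) (coord_sum eB x').
apply: eq_bigr => i _; congr (_ *: _); have := eqB (tnth e' i).
rewrite !symplectic_dual => /(congr1 ( *%R (sg K (par i)))).
by rewrite !sgM addbb !mul1r.
Qed.

Lemma symplectic_of_form : symplectic_form G B.
Proof.
split; first exact: bB.1.
- move=> z z' x y xG yG; rewrite (symplecticE _ xG) => Bxy.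
  have [//|nz] := eqVneq (z + z') 0.
  by rewrite (form_degree bQ xG yG nz) mulr0 eqxx in Bxy.
- move=> z z' x y xG yG; rewrite (symplecticE _ xG) (symplecticE _ yG).
  have [zz|nz] := eqVneq (z + z') 0; last first.
    rewrite (form_degree bQ xG yG nz) (form_degree bQ yG xG) ?mulr0 ?oppr0 //.
    by rewrite addrC.
  rewrite (form_sym bQ xG yG) expN1z oddzM !oddzD.
  have /(congr1 oddz) := zz; rewrite oddzD /=.
  by case: (oddz z); case: (oddz z') => // _;
    rewrite /sg /= ?expr0 ?expr1; ring.
move=> x Bx0; apply: symplectic_inj => y; rewrite Bx0.
exact/esym/(linear_at0 (bB.1.1 y)).
Qed.

Lemma omega_rcons (Q : seq V -> V) s y : omega_of B Q (rcons s y) = B (Q s) y.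
Proof. by case: s => //= x s; rewrite belast_rcons last_rcons. Qed.

Lemma omega_multilinear Q : coderivation Q -> multilinear (omega_of B Q).
Proof.
case=> _ lQ s t a x y; case/lastP: t => [|t z].
  by rewrite !cats1 !omega_rcons bB.1.2.
by rewrite -!rcons_cons -!rcons_cat !omega_rcons lQ bB.1.1.
Qed.

Section Omega.
Variables (Q : seq V -> V) (Omega : cform G).
Hypothesis QC : coderivation Q.
Hypothesis QD : coder_degree G 1 Q.
Hypothesis QO : cval Omega = omega_of B Q.

Local Notation phi := (fun J => Omega (ev J)).

Lemma omega_degree : has_degree 3 Omega.
Proof.
move=> w; case/lastP: w => [|w [z x]]; first by rewrite QO eqxx.
rewrite /homword all_rcons => /andP[/= xG hw].
rewrite /unzip2 map_rcons QO omega_rcons (symplecticE _ (QD hw)) => nz.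
(* [Q] of [w] lies in degree [wdeg w + 2] of V, so [B] vanishes unless z = - wdeg w - 2; the whole
   word then has degree wdeg w + z - 1 = -3. *)
have [e0|ne] := eqVneq (wdeg w + 1 + 1 + z) 0.
  rewrite -cats1 wdeg_cat wdeg_cons /= /wdeg big_nil -/(wdeg w).
  by move: e0; clear; lia.
by rewrite (form_degree bQ (QD hw) xG ne) mulr0 eqxx in nz.
Qed.

(** Omega evaluated at [Q] of the word [c], followed by [a]. *)
Let omega_in (c a : seq 'I_n) : K := \sum_i coord e i (Q (ev c)) * phi (i :: a).

Lemma coord_coderivation c i :
  par i != ~~ parity c -> coord e i (Q (ev c)) = 0.
Proof.
move=> ne; have := QD (basis_word_homword eG c); rewrite unzip2_basis_word.
move/(coord_homogeneous eB eG); apply; apply: contra ne => /eqP di.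
by rewrite /basis_par di -(oddz_wdeg d e) !oddzD /=; case: (oddz _).
Qed.

(** Rotating the second copy of Omega to B(Q(c), e_j), the sum over [j] against [N] recovers the
    coordinate [i] of Q(c): contracting two copies of Omega inserts Q into Omega. *)
Lemma glue_omega a c : glue par N phi phi a c =
  sg K (parity a && parity c) * omega_in c a.
Proof.
rewrite /glue mulr_sumr; apply: eq_bigr => i _.
transitivity (sg K ((par i (+) parity a) && parity c) * phi (i :: a)
  * (sg K (par i && parity c) * \sum_j N i j * B (Q (ev c)) (tnth e j))).
  rewrite !mulr_sumr; apply: eq_bigr => j _.
  have [eij|nij] := eqVneq (par i) (par j); last first.
    by rewrite (copairing_par bQ eB eG e'D nij) !(mul0r, mulr0).
  rewrite [phi (j :: c)](cform_basis_cyclic eG) /basis_vectors map_rcons.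
  rewrite [Omega (rcons _ _)](congr1 (@^~ _) QO) omega_rcons eij; ring.
have -> : \sum_j N i j * B (Q (ev c)) (tnth e j) =
    coord e i (Q (ev c)).
  transitivity (sg K (par i) * B (Q (ev c)) (tnth e' i)); last first.
    by rewrite symplectic_dual sgM addbb mul1r.
  rewrite [in RHS](dual_coord bQ eB e'D i).
  rewrite (linear_combination _ _ _ (bB.1.2 _)) mulr_sumr.
  by apply: eq_bigr => j _; rewrite /copairing -mulrA.
have [pi|/coord_coderivation->] := eqVneq (par i) (~~ parity c); last first.
  by rewrite !(mul0r, mulr0).
rewrite pi; set u := parity a; set v := parity c.
transitivity (sg K ((~~ v (+) u) && v) * sg K (~~ v && v)
  * (coord e i (Q (ev c)) * phi (i :: a))); first by ring.
by rewrite -sgD; congr (sg K _ * _); case: u; case: v.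
Qed.

Lemma omega_parity : has_parity par true phi.
Proof. exact: (has_degree_parity eB eG omega_degree). Qed.

(** Rotating the arguments puts [x] last, where Omega is [B] of a value of [Q]; a composite of [Q]
    with itself appears. *)
Lemma omega_in_rot c1 c2 d1 x : omega_in c2 (d1 ++ x :: c1) =
  sg K ((~~ parity c2 (+) (par x (+) parity d1)) && parity c1)
  * B (Q (ev c1 ++ Q (ev c2) :: ev d1)) (tnth e x).
Proof.
have -> : B (Q (ev c1 ++ Q (ev c2) :: ev d1)) (tnth e x) =
    Omega (ev c1 ++ Q (ev c2) :: rcons (ev d1) (tnth e x)).
  by rewrite -rcons_cons -rcons_cat [RHS](congr1 (@^~ _) QO) omega_rcons.
rewrite [in RHS](coord_sum eB (Q (ev c2))).
rewrite (linear_combination _ _ _ (cform_multilinear Omega _ _)) mulr_sumr.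
apply: eq_bigr => i _.
have [pi|/coord_coderivation->] :=
  eqVneq (par i) (~~ parity c2); last first.
  by rewrite scale0r mulr0 mul0r.
rewrite mulrCA -pi; congr (_ * _).
rewrite -cat_rcons -[i :: _]/((i :: rcons d1 x) ++ c1).
rewrite [LHS](cyclic_cat _ _ (@cform_basis_cyclic _ _ _ _ _ _ eG Omega)).
rewrite parity_cons parity_rcons; congr (_ * Omega _).
by rewrite /basis_vectors map_cat /= map_rcons.
Qed.

Lemma coder_comp_cut J y : B (coder_comp 1 Q Q (basis_word d e J)) y =
  cut (fun c1 u => cut (fun c2 d1 => sg K (parity c1)
    * B (Q (ev c1 ++ Q (ev c2) :: ev d1)) y) u) J.
Proof.
(* [cut] also gives the inner [Q] an empty argument, which [coder_comp] does not; these extra terms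
   vanish because [Q [::] = 0]. *)
have Q0 s t : B (Q (s ++ Q (ev [::]) :: t)) y = 0.
  rewrite [Q (ev [::])]QC.1 (linear_at0 (QC.2 s t)).
  exact: (linear_at0 (bB.1.1 y)).
rewrite cutE big_ord_recr /= drop_size /= Q0 mulr0 addr0 /coder_comp size_map.
have BL := linear_combination (index_enum _) _ _ (bB.1.1 y).
transitivity (\sum_(i < size J) B (\sum_(j < size J - i)
   (-1) ^ (1 * wdeg (take i (basis_word d e J))) *:
      Q (unzip2 (take i (basis_word d e J))
         ++ Q (unzip2 (take j.+1 (drop i (basis_word d e J))))
           :: unzip2 (drop (i + j.+1) (basis_word d e J)))) y).
  rewrite -[RHS](eq_bigr _ (fun i _ => scale1r _)).
  rewrite -[RHS](linear_combination _ _ _ (bB.1.1 y)).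
  by congr B; apply: eq_bigr => i _; rewrite scale1r.
apply: eq_bigr => i _; rewrite (linear_combination _ _ _ (bB.1.1 y)).
rewrite cutE big_ord_recl take0 Q0 mulr0 add0r size_drop.
apply: eq_bigr => j _; rewrite mul1r lift0 drop_drop [(j.+1 + i)%N]addnC.
rewrite -!map_take -!map_drop -map_take !unzip2_basis_word expN1z.
by rewrite oddz_wdeg.
Qed.

Lemma bracket_omega_cons x u : bracket par N phi phi (x :: u) =
  2%:R * (sg K (par x && parity u)
          * B (coder_comp 1 Q Q (basis_word d e u)) (tnth e x)).
Proof.
pose S := cut (fun c v => cut (fun c1 c2 =>
  sg K ((par x (+) parity (c1 ++ c2)) && parity v)
  * glue par N phi phi (v ++ x :: c1) c2) c) u.
have -> : bracket par N phi phi (x :: u) = 2%:R * S.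
  rewrite /bracket rotsum_cut_cons mulr_natl mulr2n; congr (_ + _).
  rewrite /S (cutA (fun c1 c2 v => sg K ((par x (+) parity (c1 ++ c2))
    && parity v) * glue par N phi phi (v ++ x :: c1) c2)).
  apply: eq_cut => a u' _; apply: eq_cut => c1 c2 _.
  (* Omega is odd, so the minus sign of the antisymmetry meets a second one: the two sums add up
     instead of cancelling. *)
  have := glueC (copairing_antisym bQ eB eG e'D) (copairing_par bQ eB eG e'D)
    c1 (c2 ++ x :: a) omega_parity omega_parity.
  rewrite /= {2}/sg expr1 mulN1r opprK => <-; rewrite sgM; congr (sg K _ * _).
  by parity_cases (basis_par d).
congr (_ * _); rewrite coder_comp_cut -cutZ /S.
rewrite (cutA (fun c1 c2 v => sg K ((par x (+) parity (c1 ++ c2))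
    && parity v) * glue par N phi phi (v ++ x :: c1) c2)).
apply: eq_cut => c1 u' <-; rewrite -cutZ; apply: eq_cut => c2 v <-.
rewrite glue_omega omega_in_rot !sgM; congr (sg K _ * _).
by parity_cases (basis_par d).
Qed.

Lemma bracket_omega_eq0 :
  [pchar K] =i pred0 ->
  (forall w, homword G w -> coder_commutator 1 1 Q Q w = 0) ->
  form_bracket b eB eG e' Omega Omega = 0.
Proof.
move=> charK QQ; apply: (cform_eq eB) => J; rewrite form_bracket_basis.
rewrite [RHS](_ : _ = 0) //; case: J => [|x u].
  (* At the empty word each copy of Omega has one argument, and its value is B(Q [::], e_i) = 0. *)
  rewrite /bracket /= /glue big1 // => i _; rewrite big1 // => j _.
  rewrite [Omega (ev [:: i])](congr1 (@^~ _) QO) /= QC.1.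
  rewrite (linear_at0 (bB.1.1 _)).
  by rewrite !(mul0r, mulr0).
rewrite bracket_omega_cons.
(* As [Q] is odd, its commutator with itself is twice the composite, and characteristic 0 allows
   division by 2. *)
have comp0 : coder_comp 1 Q Q (basis_word d e u) = 0.
  have := QQ _ (basis_word_homword eG u); rewrite /coder_commutator expN1z.
  rewrite scaleN1r opprK -mulr2n -scaler_nat => /eqP; rewrite scaler_eq0.
  by have /pcharf0P-> := charK => /eqP.
by rewrite comp0 (linear_at0 (bB.1.1 _)) !mulr0.
Qed.

End Omega.
End Symplectic.

Section Uniqueness.
Variables (K : fieldType) (V : vectType K) (G : grading V).

Lemma bracket_of_unique (b : V -> V -> K^o)
    (br1 br2 : cform G -> cform G -> cform G) :
  quadratic_form G b -> bracket_of b br1 -> bracket_of b br2 -> br1 = br2.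
Proof.
move=> bQ b1 b2; apply/funext => f; apply/funext => g.
have [n [d [e [eB eG]]]] := homogeneous_basis G.
have [e' e'D] := dual_basis bQ eB.
apply: (cform_eq eB) => J; rewrite -(unzip2_basis_word d).
rewrite (b1 _ _ _ _ _ _ eB eG e'D) ?basis_word_homword //.
by rewrite (b2 _ _ _ _ _ _ eB eG e'D) ?basis_word_homword.
Qed.

End Uniqueness.

Lemma pinczon_of_A_infinity (K : fieldType) (charK : [pchar K] =i pred0)
    (V : vectType K) (G : grading V) (b B : V -> V -> K^o) :
  quadratic_form G b -> symplectic_of G b B ->
  forall Q : seq V -> V, A_infinity G Q -> B_quadratic G B Q ->
  exists! P : (cform G -> cform G -> cform G) * cform G,
    [/\ bracket_of b P.1, cval P.2 = omega_of B Q & assoc_pinczon P.1 P.2].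
Proof.
move=> bQ bB Q [QC QD QQ] QB.
have [n [d [e [eB eG]]]] := homogeneous_basis G.
have [e' e'D] := dual_basis bQ eB.
pose Omega : cform G := @CForm _ _ G (omega_of B Q)
  (asboolT (conj (omega_multilinear bB QC) QB)).
have OQ : cval Omega = omega_of B Q by [].
exists (form_bracket b eB eG e', Omega); split.
  split=> //=; first exact: form_bracket_of.
  split; first exact: form_bracket_pinczon.
    exact: (omega_degree bQ bB QD OQ).
  exact: (bracket_omega_eq0 bQ bB eB eG e'D QC QD OQ charK QQ).
move=> [br Om] /= [bbr OmQ _]; congr (_, _).
  by apply: (bracket_of_unique bQ) bbr; apply: form_bracket_of.
by apply: val_inj.
Qed.

(** * The quadratic form of a Pinczon bracket *)

Lemma rotsum_of_cyclic (K : comNzRingType) (T : Type) (par : T -> bool)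
    (F : seq T -> K) w :
  cyclic par F -> rotsum par F w = (maxn 1 (size w))%:R * F w.
Proof.
move=> cF; rewrite rotsumE mulr_natl -[X in _ *+ X]card_ord -sumr_const.
apply: eq_bigr => r _.
by rewrite -[in RHS](cat_take_drop r w) (cyclic_cat _ _ cF).
Qed.

(** * Cyclized products of coordinate forms *)

Section TensorSpan.
Variables (K : fieldType) (V : vectType K) (G : grading V).
Hypothesis charK : [pchar K] =i pred0.
Variables (n : nat) (d : n.-tuple int) (e : n.-tuple V).
Hypothesis eB : basis_of fullv e.
Hypothesis eG : forall i, tnth e i \in G (tnth d i).
Implicit Types (f g h : cform G).

Local Notation par := (basis_par d).
Local Notation ev := (basis_vectors e).
Local Notation coordinate := (coordinate_form eB eG).

Definition coordinates (I : seq 'I_n) : seq (int * cform G) :=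
  [seq (1 - tnth d i, coordinate i) | i <- I].

Local Notation coordinate_tens I := (tens par (basis_tensor e (coordinates I))).

Lemma coordinate_tens_cons i I j J : coordinate_tens (i :: I) (j :: J) =
  sg K (word_parity fst (basis_tensor e (coordinates I)) && par j) * (j == i)%:R
  * coordinate_tens I J.
Proof.
congr (_ * _ * _).
rewrite -[LHS]/(coordinate i (ev [:: j])).
by rewrite coordinate_form_basis eqseq_cons andbT.
Qed.

Lemma coordinate_tens_neq I J : J != I -> coordinate_tens I J = 0.
Proof.
elim: I J => [|i I IHI] [|j J] //; rewrite eqseq_cons => ne.
rewrite coordinate_tens_cons.
case: eqP ne => [->|_]; last by rewrite mulr0 mul0r.
by move/IHI->; rewrite mulr0.
Qed.

Lemma coordinate_tens_diag I : coordinate_tens I I != 0.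
Proof.
elim: I => [|i I IHI]; first exact: oner_neq0.
by rewrite coordinate_tens_cons eqxx mulr1 mulf_neq0 ?signr_eq0.
Qed.

Definition coordinate_product I : cform G :=
  cform_of eB eG (@rotsum_cyclic _ _ par (coordinate_tens I)).

Lemma coordinate_product_cycl I :
  is_cycl (coordinate_product I) (tensor (coordinates I)).
Proof.
move=> w; apply: (letterwise_linear_eq eB eG
  (F := fun w => coordinate_product I (unzip2 w))
  (F' := cycl (tensor (coordinates I)))).
- by apply: multilinear_letterwise; apply: cform_multilinear.
- by apply: cycl_letterwise; apply: tensor_letterwise.
move=> J; rewrite unzip2_basis_word [LHS]cform_of_basis cycl_basis.
by apply: eq_rotsum => J'; rewrite tensor_basis.
Qed.

Lemma coordinates_homogeneous I :
  {in coordinates I, forall c, has_arity 1 c.2 /\ has_degree c.1 c.2}.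
Proof.
move=> c /mapP[i _ ->]; split; first exact: coordinate_form_arity.
exact: coordinate_form_degree.
Qed.

(** Forms are corrected one arity at a time. The error in arity [m] is cyclic, hence equal to the
    average of its rotations, which is a finite combination of cyclized products; [L] kills each of
    these. *)
Lemma coordinate_products_span (L : cform G -> cform G) g m :
  linear L -> (forall I, L (coordinate_product I) = 0) ->
  exists2 h, L h = 0 & forall J, (size J < m)%N -> h (ev J) = g (ev J).
Proof.
move=> lL L0; elim: m => [|m [h Lh hg]]; first by exists 0; rewrite ?linear_at0.
pose M : K := (maxn 1 m)%:R.
have M0 : M != 0 by have /pcharf0P-> := charK; rewrite -lt0n leq_max.
pose r J : K := g (ev J) - h (ev J).
have cr : cyclic par r.
  by move=> i J; rewrite /r !(cform_basis_cyclic eG) mulrBr.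
(* [coordinate_tens I I] is the sign of the monomial at its own word, and [M] is the number of
   rotations, invertible in characteristic 0. *)
pose a (I : m.-tuple 'I_n) : K := r I / (coordinate_tens I I * M).
exists (h + \sum_I a I *: coordinate_product I).
  rewrite -[h]scale1r lL Lh scaler0 add0r (linear_combination _ _ _ lL).
  by rewrite big1 // => I _; rewrite L0 scaler0.
move=> J szJ.
rewrite -[LHS]/(h (ev J) + (\sum_I a I *: coordinate_product I) (ev J)).
rewrite (@linear_combination _ _ K^o (fun f => f (ev J))) //.
have sE J' : \sum_I a I * coordinate_tens I J' =
    if size J' == m then M^-1 * r J' else 0.
  case: eqP => [szJ'|nsz]; last first.
    rewrite big1 // => I _; rewrite coordinate_tens_neq ?mulr0 //.
    by apply/eqP => eJ; case: nsz; rewrite eJ size_tuple.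
  have /eqP tJ := szJ'; rewrite (bigD1 (Tuple tJ)) //= big1 => [|I nI].
    by rewrite addr0 /a /=; field; rewrite M0 coordinate_tens_diag.
  rewrite coordinate_tens_neq ?mulr0 //.
  by apply: contra nI => /eqP eI; apply/eqP/val_inj.
transitivity (h (ev J) + rotsum par (fun J' =>
    if size J' == m then M^-1 * r J' else 0) J).
  congr (_ + _); rewrite -(eq_rotsum _ _ sE) rotsum_sum.
  apply: eq_bigr => I _; rewrite [coordinate_product _ _]cform_of_basis.
  by rewrite rotsumZ.
rewrite rotsumE; have [szm|nsz] := eqVneq (size J) m; last first.
  rewrite big1 ?addr0 => [|k _]; last by rewrite size_rot (negPf nsz) mulr0.
  by apply: hg; rewrite ltn_neqAle nsz -ltnS.
transitivity (h (ev J) + rotsum par (fun J' => M^-1 * r J') J).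
  rewrite [in RHS]rotsumE; congr (_ + _); apply: eq_bigr => k _.
  by have -> : size (rot k J) == m by rewrite size_rot; apply/eqP.
rewrite rotsumZ rotsum_of_cyclic //.
by rewrite szm -/M mulKf // /r addrC subrK.
Qed.

Lemma bracket_linear_ext (br1 br2 : cform G -> cform G -> cform G) a1 a2 :
  bilinear_map br1 -> arity_axiom br1 -> derivation_axiom br1 ->
  bilinear_map br2 -> arity_axiom br2 -> derivation_axiom br2 ->
  has_arity 1 a1 -> has_arity 1 a2 ->
  (forall i, br1 a1 (coordinate i) [::] = br2 a2 (coordinate i) [::]) ->
  br1 a1 =1 br2 a2.
Proof.
move=> bil1 ar1 der1 bil2 ar2 der2 h1 h2 eq12 g.
pose L f := br1 a1 f - br2 a2 f.
have lL : linear L.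
  move=> a x y; rewrite /L bil1.2 bil2.2 opprD addrACA scalerBr.
  by rewrite -scalerN.
have L0 I : L (coordinate_product I) = 0.
  apply/eqP; rewrite subr_eq0; apply/eqP; apply: (cform_eq eB) => J.
  rewrite -!(unzip2_basis_word d).
  have hI := @coordinates_homogeneous I; have cI := @coordinate_product_cycl I.
  rewrite (der1 _ _ _ h1 hI cI) ?(der2 _ _ _ h2 hI cI) ?basis_word_homword //.
  apply: eq_bigr => t _; congr (_ * _ * _).
  have [i _ ->] := mapP (mem_nth (0, 0) (ltn_ord t)).
  exact: eq12.
apply/eqP; rewrite -subr_eq0; apply/eqP; apply: (cform_eq eB) => J.
(* Agreement below length |J| + 3 makes [g - h] vanish up to |J| + 2, and the continuity half of
   [arity_axiom] makes its brackets vanish up to |J|. *)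
have [h Lh hg] := coordinate_products_span g (size J).+3 lL L0.
have -> : br1 a1 g - br2 a2 g = L (g - h).
  have -> : g - h = (-1) *: h + g by rewrite scaleN1r addrC.
  by rewrite lL Lh scaler0 add0r.
have gh : vanish_upto (size J).+2 (g - h).
  move=> s sz; apply: (cform_size0 eB (m := size s)) => // J' sz'.
  rewrite -[LHS]/(g (ev J') - h (ev J')) hg ?subrr //.
  by rewrite sz' ltnS.
rewrite -[LHS]/(br1 a1 (g - h) (ev J) - br2 a2 (g - h) (ev J)).
rewrite (ar1.2 _ _ a1 gh).2 ?(ar2.2 _ _ a2 gh).2 ?size_map // subrr.
by [].
Qed.

Lemma linear_form_sum (a : cform G) : has_arity 1 a ->
  a = \sum_i (a [:: tnth e i] : K) *: coordinate i.
Proof.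
move=> a1; apply: (cform_eq eB) => J.
rewrite (@linear_combination _ _ K^o (fun f => f (ev J))) //.
have [szJ|nsz] := eqVneq (size J) 1; last first.
  rewrite a1 ?size_map // big1 // => i _.
  by rewrite coordinate_form_arity ?size_map ?scaler0.
case: J szJ => [|j [|//]] // _.
rewrite (bigD1 j) // big1 => [|i ni].
  rewrite [RHS]addr0 -[RHS]/(a [:: tnth e j] * coordinate j (ev [:: j])).
  by rewrite coordinate_form_basis eqxx mulr1.
rewrite coordinate_form_basis eqseq_cons.
by rewrite eq_sym (negPf ni) scaler0.
Qed.

End TensorSpan.

(** * The pairing of linear forms and its inverse *)

Section FormOfBracket.
Variables (K : fieldType) (V : vectType K) (G : grading V).
Hypothesis charK : [pchar K] =i pred0.
Variables (n : nat) (d : n.-tuple int) (e : n.-tuple V).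
Hypothesis eB : basis_of fullv e.
Hypothesis eG : forall i, tnth e i \in G (tnth d i).
Variable br : cform G -> cform G -> cform G.
Hypothesis brP : pinczon_bracket br.

Local Notation par := (basis_par d).
Local Notation ev := (basis_vectors e).
Local Notation coordinate := (coordinate_form eB eG).

Let brL : bilinear_map br. Proof. by case: brP. Qed.
Let brA : arity_axiom br. Proof. by case: brP. Qed.
Let brG : graded_lie br. Proof. by case: brP. Qed.
Let brD : derivation_axiom br. Proof. by case: brP. Qed.
Let brC : center_axiom br. Proof. by case: brP. Qed.

Let coordinate_degree i : has_degree (1 - tnth d i) (coordinate i).
Proof. exact: coordinate_form_degree. Qed.

Definition linear_bracket i j : K := br (coordinate i) (coordinate j) [::].

Lemma linear_bracket_suml (r : 'I_n -> K) j :
  br (\sum_i r i *: coordinate i) (coordinate j) [::] =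
  \sum_i r i * linear_bracket i j.
Proof.
rewrite (linear_combination _ _ _ (brL.1 _)).
by rewrite (@linear_combination _ _ K^o (fun f : cform G => f [::])).
Qed.

(** The bracket has degree (1 - d_i) + (1 - d_j) - 2, and a nonzero scalar has degree 0. *)
Lemma linear_bracket_degree i j :
  tnth d i + tnth d j != 0 -> linear_bracket i j = 0.
Proof.
move=> nij; have [deg _ _] := brG.
have := deg _ _ _ _ (@coordinate_degree i) (@coordinate_degree j) [::] isT.
rewrite -/(linear_bracket i j); have [//|_] := eqVneq (linear_bracket i j) 0.
move/(_ isT); rewrite /wdeg big_nil; move: nij; clear; lia.
Qed.

Lemma linear_bracket_antisym i j : linear_bracket i j =
  - (sg K (par i && par j) * linear_bracket j i).
Proof.
have [_ anti _] := brG.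
have := anti _ _ _ _ (@coordinate_degree i) (@coordinate_degree j).
move/(congr1 (fun f : cform G => f [::])); rewrite -/(linear_bracket i j) => ->.
rewrite expN1z oddzM /basis_par.
by rewrite -[1 - tnth d i]opprB -[1 - tnth d j]opprB !oddzN.
Qed.

(** If the brackets of coordinate forms are the [copairing] of a form b, then removing its sign
    leaves b(e'_i, e'_j), the coordinate [j] of e'_i: row [i] must be the dual vector e'_i. *)
Definition dual_matrix : 'M[K]_n :=
  \matrix_(i, j) (sg K (par i) * linear_bracket i j).

Lemma dual_matrix_unit : dual_matrix \in unitmx.
Proof.
rewrite -row_free_unit -kermx_eq0; apply/eqP/row_matrixP => k.
rewrite row0; set r := row k _.
have rM : r *m dual_matrix = 0 by apply/sub_kermxP; apply: row_sub.
pose a : cform G := \sum_i (r 0 i * sg K (par i)) *: coordinate i.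
have aj j : br a (coordinate j) [::] = 0.
  rewrite linear_bracket_suml; have := congr1 (fun M : 'rV_n => M 0 j) rM.
  rewrite mxE [RHS]mxE => rj; rewrite -[RHS]rj; apply: eq_bigr => i _.
  by rewrite [dual_matrix i j]mxE mulrA.
have asum s : a s = \sum_i (r 0 i * sg K (par i)) * coordinate i s.
  by rewrite (@linear_combination _ _ K^o (fun f : cform G => f s)).
have a1 : has_arity 1 a.
  move=> s sz; rewrite asum big1 // => i _.
  by rewrite coordinate_form_arity ?mulr0.
have a3 s : (2 < size s)%N -> a s = 0.
  by move=> sz; rewrite a1 //; apply: contraTneq sz => ->.
(* [br a] and [br 0] agree on the coordinate forms, hence everywhere. *)
have central g : br a g = 0.
  have z1 : has_arity 1 (0 : cform G) by [].
  have az i : br a (coordinate i) [::] = br 0 (coordinate i) [::].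
    by rewrite aj (linear_at0 (brL.1 _)).
  rewrite (bracket_linear_ext charK brL brA brD brL brA brD a1 z1 az).
  exact: (linear_at0 (brL.1 g)).
have a0 := brC.2 a a3 central.
apply/rowP => i; rewrite [RHS]mxE.
have := a0 (ev [:: i]) isT; rewrite asum (bigD1 i) // big1 => [|j nj].
  rewrite [LHS]addr0 coordinate_form_basis eqxx mulr1 => /eqP.
  by rewrite mulf_eq0 signr_eq0 orbF => /eqP.
by rewrite coordinate_form_basis eqseq_cons eq_sym (negPf nj) mulr0.
Qed.

Local Notation W := (invmx dual_matrix).

(** [D] and [D'] project onto the degree of [e_l] and onto the opposite one. That the matrix
    exchanges degrees is the relation M D = D' M, which passes to the inverse. *)
Lemma dual_matrix_inv_degree l k : tnth d l + tnth d k != 0 -> W l k = 0.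
Proof.
move=> nlk; pose t z : K := (z == tnth d l)%:R.
pose D : 'M[K]_n := diag_mx (\row_i t (tnth d i)).
pose D' : 'M[K]_n := diag_mx (\row_i t (- tnth d i)).
have DM : dual_matrix *m D = D' *m dual_matrix.
  apply/matrixP => i j; rewrite mul_mx_diag mul_diag_mx !mxE.
  have [z|nz] := eqVneq (tnth d i + tnth d j) 0.
    have -> : tnth d j = - tnth d i by apply/eqP; rewrite -addr_eq0 addrC z.
    exact: mulrC.
  by rewrite linear_bracket_degree // !(mulr0, mul0r).
have DW : W *m D' = D *m W.
  rewrite -[LHS]mulmx1 -(mulmxV dual_matrix_unit) mulmxA -[_ *m D' *m _]mulmxA.
  by rewrite -DM !mulmxA mulVmx ?dual_matrix_unit // mul1mx.
have := congr1 (fun M : 'M_n => M l k) DW; rewrite mul_mx_diag mul_diag_mx !mxE.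
rewrite {2}/t eqxx mul1r => <-; rewrite /t eq_sym -addr_eq0 (negPf nlk) mulr0.
by [].
Qed.

(** Graded symmetry reads M = E M^T with [E] a diagonal of signs. Multiplying by W^T gives M W^T =
    E, hence W^T = W E. *)
Lemma dual_matrix_inv_sym l k : W l k = sg K (oddz (tnth d l)) * W k l.
Proof.
pose E : 'M[K]_n := diag_mx (\row_i sg K (oddz (tnth d i))).
have ME : dual_matrix = E *m dual_matrix^T.
  apply/matrixP => i j; rewrite mul_diag_mx !mxE.
  have [z|nz] := eqVneq (tnth d i + tnth d j) 0; last first.
    by rewrite !linear_bracket_degree ?mulr0 // addrC.
  rewrite linear_bracket_antisym /basis_par !oddzD.
  have := congr1 oddz z; rewrite oddzD /=.
  by case: (oddz (tnth d i)); case: (oddz (tnth d j)) => // _;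
    rewrite /sg /= ?expr0 ?expr1; ring.
have EE : E *m E = 1%:M.
  apply/matrixP => i j; rewrite mul_diag_mx !mxE.
  by case: eqP => _; rewrite ?mulr0 // -expr2 sqrr_sign.
have MW : dual_matrix *m W^T = E.
  rewrite [X in X *m _]ME -mulmxA -trmx_mul.
  by rewrite mulVmx ?dual_matrix_unit // trmx1 mulmx1.
have WE : W^T = W *m E.
  by rewrite -[LHS]mul1mx -(mulVmx dual_matrix_unit) -mulmxA MW.
have := congr1 (fun M : 'M_n => M k l) WE; rewrite mul_mx_diag !mxE => ->.
by rewrite mulrC.
Qed.

(** As e'_j is row [j] of [dual_matrix], requiring b(e_k, e'_j) to be the Kronecker symbol forces
    b(e_k, e_l) to be [W l k], with the indices in this order. *)
Definition bracket_form (x y : V) : K^o :=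
  \sum_k \sum_l coord e k x * coord e l y * W l k.

Definition bracket_dual_basis : n.-tuple V :=
  [tuple \sum_j dual_matrix i j *: tnth e j | i < n].

Lemma bracket_formr x i :
  bracket_form x (tnth bracket_dual_basis i) = coord e i x.
Proof.
rewrite tnth_mktuple.
transitivity (\sum_k coord e k x * (dual_matrix *m W) i k).
  apply: eq_bigr => k _; rewrite mxE mulr_sumr; apply: eq_bigr => l _.
  rewrite linear_sum (bigD1 l) //= linearZ /= (coord_tnth eB) eqxx mulr1 big1.
    by rewrite addr0 mulrA.
  by move=> j nj; rewrite linearZ /= (coord_tnth eB) (negPf nj) mulr0.
rewrite mulmxV ?dual_matrix_unit // (bigD1 i) //= big1 => [|k nk].
  by rewrite mxE eqxx mulr1 addr0.
by rewrite mxE eq_sym (negPf nk) mulr0.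
Qed.

Lemma bracket_dual i j :
  bracket_form (tnth e i) (tnth bracket_dual_basis j) = (i == j)%:R.
Proof. by rewrite bracket_formr (coord_tnth eB). Qed.

Lemma bracket_form_quadratic : quadratic_form G bracket_form.
Proof.
have nz z z' x y k l : x \in G z -> y \in G z' ->
    (tnth d k != z) || (tnth d l != z') || (z + z' != 0) ->
    coord e k x * coord e l y * W l k = 0.
  move=> xG yG; have [<-|nk] := eqVneq (tnth d k) z; last first.
    by rewrite (coord_homogeneous eB eG xG nk) !mul0r.
  have [<-|nl] := eqVneq (tnth d l) z'; last first.
    by rewrite (coord_homogeneous eB eG yG nl) mulr0 mul0r.
  by move=> /= nkl; rewrite dual_matrix_inv_degree ?mulr0 // addrC.
split.
- split=> [y|x] c u v; rewrite /bracket_form scaler_sumr -big_split;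
    apply: eq_bigr => k _; rewrite scaler_sumr -big_split;
    apply: eq_bigr => l _; rewrite linearP /=.
    by rewrite [in RHS]/GRing.scale /=; ring.
  by rewrite [in RHS]/GRing.scale /=; ring.
- move=> z z' x y xG yG; have [//|ne] := eqVneq (z + z') 0.
  rewrite /bracket_form big1 ?eqxx // => k _; rewrite big1 // => l _.
  by rewrite (nz _ _ _ _ _ _ xG yG) // ne !orbT.
- move=> z z' x y xG yG; rewrite /bracket_form exchange_big mulr_sumr.
  apply: eq_bigr => k _; rewrite mulr_sumr; apply: eq_bigr => l _.
  have [ne|] := boolP ((tnth d k != z) || (tnth d l != z') || (z + z' != 0)).
    rewrite [X in _ = _ * X](nz _ _ _ _ _ _ xG yG ne) mulr0.
    by apply: (nz _ _ _ _ _ _ yG xG); rewrite addrC [X in X || _]orbC.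
  rewrite !negb_or !negbK => /andP[/andP[/eqP dk /eqP dl] /eqP zz].
  rewrite dual_matrix_inv_sym dk expN1z oddzM.
  have -> : oddz z' = oddz z.
    by have := congr1 oddz zz; rewrite oddzD; case: (oddz z); case: (oddz z').
  by rewrite andbb mulrCA [coord e l y * _]mulrC.
move=> x bx0; rewrite (coord_sum eB x) big1 // => i _.
by rewrite -bracket_formr bx0 scale0r.
Qed.

(** By construction [br] and the contraction bracket of [bracket_form] pair linear forms alike; for
    a linear first argument, [bracket_linear_ext] propagates this to every second argument. *)
Lemma bracket_form_of : form_of br bracket_form.
Proof.
have bQ := bracket_form_quadratic; split=> // a g a1; rewrite /bracket_formula.
have -> : br a g = form_bracket bracket_form eB eG bracket_dual_basis a g.
  have [bil ar _ der _] := form_bracket_pinczon bQ eB eG bracket_dual.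
  suff eq_br j : br a (coordinate j) [::] =
      form_bracket bracket_form eB eG bracket_dual_basis a (coordinate j) [::].
    exact: (bracket_linear_ext charK brL brA brD bil ar der a1 a1 eq_br).
  rewrite -[[::] in RHS]/(ev [::]) form_bracket_coordinate //.
  rewrite [in LHS](linear_form_sum eB eG a1) linear_bracket_suml.
  apply: eq_bigr => i _; rewrite /copairing bracket_formr mulrC.
  congr (_ * _); rewrite tnth_mktuple linear_sum (bigD1 j) //= big1 => [|k nk].
    by rewrite linearZ /= (coord_tnth eB) eqxx mulr1 addr0 mxE sgM addbb mul1r.
  by rewrite linearZ /= (coord_tnth eB) (negPf nk) mulr0.
exact: (form_bracket_of bQ eB eG bracket_dual).
Qed.

End FormOfBracket.

(** On two coordinate forms the formula returns the copairing, so [br] determines the dual basis; a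
    form is in turn recovered from it, since b(x, e'_j) is the coordinate [j] of [x]. *)
Lemma form_of_unique (K : fieldType) (V : vectType K) (G : grading V)
    (br : cform G -> cform G -> cform G) (b1 b2 : V -> V -> K^o) :
  form_of br b1 -> form_of br b2 -> b1 = b2.
Proof.
have [n [d [e [eB eG]]]] := homogeneous_basis G.
have dualE b (e' : n.-tuple V) : form_of br b ->
    (forall i j, b (tnth e i) (tnth e' j) = (i == j)%:R) ->
    forall i, tnth e' i = \sum_j (sg K (basis_par d i)
      * br (coordinate_form eB eG i) (coordinate_form eB eG j) [::])
      *: tnth e j.
  move=> [bQ bbr] e'D i; rewrite [LHS](coord_sum eB); apply: eq_bigr => j _.
  congr (_ *: _); rewrite (coord_dual bQ eB e'D).
  have arity_i := @coordinate_form_arity _ _ _ _ _ _ eB eG i.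
  rewrite (bbr _ _ arity_i _ _ _ _ eB eG e'D [::]) //.
  rewrite -(@form_bracket_contraction _ _ _ _ bQ _ _ _ eB eG _ e'D _ _ [::]) //.
  rewrite -[unzip2 [::]]/(basis_vectors e [::]) form_bracket_coordinate //.
  rewrite (bigD1 i) // big1 => [|k nk].
    rewrite [X in _ = _ * X]addr0 coordinate_form_basis eqxx mulr1 /copairing.
    by rewrite sgM addbb mul1r.
  by rewrite coordinate_form_basis eqseq_cons (negPf nk) mulr0.
move=> f1 f2; have [b1Q b2Q] := (f1.1, f2.1).
have [e1 e1D] := dual_basis b1Q eB; have [e2 e2D] := dual_basis b2Q eB.
have e12 i : tnth e1 i = tnth e2 i.
  by rewrite (dualE _ _ f1 e1D) (dualE _ _ f2 e2D).
apply/funext => x; apply/funext => y.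
rewrite (dual_sum b1Q eB eG e1D y).
rewrite (linear_combination _ _ _ (form_linearr b1Q x)).
rewrite (linear_combination _ _ _ (form_linearr b2Q x)).
apply: eq_bigr => j _.
by rewrite -(coord_dual b1Q eB e1D) e12 (coord_dual b2Q eB e2D).
Qed.

Lemma symplectic_of_exists (K : fieldType) (V : vectType K) (G : grading V)
    (b : V -> V -> K^o) :
  quadratic_form G b -> exists B, symplectic_of G b B.
Proof.
move=> bQ; have [n [d [e [eB eG]]]] := homogeneous_basis G.
exists (fun x y =>
  \sum_i coord e i x * (sg K (basis_par d i) * b (tnth e i) y)).
split; first split=> [y|x] c u v.
- rewrite scaler_sumr -big_split; apply: eq_bigr => i _.
  by rewrite linearP [in RHS]/GRing.scale /=; ring.
- rewrite scaler_sumr -big_split; apply: eq_bigr => i _.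
  by rewrite (form_linearr bQ) /GRing.scale /=; ring.
move=> z x y xG; rewrite (form_suml bQ eB x y) mulr_sumr expN1z.
apply: eq_bigr => i _.
have [<-|nz] := eqVneq (tnth d i) z; first by rewrite mulrCA.
by rewrite (coord_homogeneous eB eG xG nz) !(mul0r, mulr0).
Qed.

Lemma symplectic_of_unique (K : fieldType) (V : vectType K) (G : grading V)
    (b B1 B2 : V -> V -> K^o) :
  symplectic_of G b B1 -> symplectic_of G b B2 -> B1 = B2.
Proof.
move=> bB1 bB2; have [n [d [e [eB eG]]]] := homogeneous_basis G.
apply/funext => x; apply/funext => y.
by rewrite (symplectic_sum bB1 eB eG) (symplectic_sum bB2 eB eG).
Qed.

(** Nondegeneracy of [B] solves B(Q(s), y) = Omega(s, y) uniquely for Q(s). The vanishing on words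
    of length 0 and 1 matches the convention of [omega_of] at the empty word and the condition [Q
    [::] = 0]. *)
Lemma coderivation_of_form (K : fieldType) (V : vectType K) (G : grading V)
    (b B : V -> V -> K^o) (Omega : cform G) :
  quadratic_form G b -> symplectic_of G b B ->
  Omega [::] = 0 -> (forall x, Omega [:: x] = 0) ->
  exists! Q : seq V -> V,
    [/\ coderivation Q, B_quadratic G B Q & cval Omega = omega_of B Q].
Proof.
move=> bQ bB O0 O1; have [n [d [e [eB eG]]]] := homogeneous_basis G.
have [e' e'D] := dual_basis bQ eB.
(* The sign is that of [symplectic_dual], which reads the coordinate [j] through B( . , e'_j). *)
pose Q s := \sum_j
  (sg K (basis_par d j) * Omega (rcons s (tnth e' j))) *: tnth e j.
have BQ s y : B (Q s) y = Omega (rcons s y).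
  rewrite (dual_sum bQ eB eG e'D y) (linear_combination _ _ _ (bB.1.2 _)).
  rewrite -!cats1 (linear_combination _ _ _ (cform_multilinear Omega s [::])).
  apply: eq_bigr => j _; congr (_ *: _).
  rewrite (symplectic_dual bB eB eG e'D) /Q linear_sum (bigD1 j) //= big1.
    rewrite linearZ /= (coord_tnth eB) eqxx mulr1 addr0 sgM addbb mul1r.
    by rewrite cats1.
  by move=> k nk; rewrite linearZ /= (coord_tnth eB) (negPf nk) mulr0.
have OQ : cval Omega = omega_of B Q.
  apply/funext => s; case/lastP: s => [|s y]; first exact: O0.
  by rewrite omega_rcons BQ.
exists Q; split.
  split=> //; last by rewrite /B_quadratic -OQ; apply: cform_koszul.
  split; first by rewrite /Q big1 // => j _; rewrite O1 mulr0 scale0r.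
  move=> s t a x y; apply: (symplectic_inj bB eB eG e'D) => z.
  rewrite bB.1.1 !BQ !rcons_cat !rcons_cons.
  exact: (cform_multilinear Omega).
move=> Q' [_ _ OQ']; apply/funext => s.
apply: (symplectic_inj bB eB eG e'D) => y.
by rewrite -!omega_rcons -OQ -OQ'.
Qed.

Theorem proposition4p2 (K : fieldType) (charK : [pchar K] =i pred0)
    (V : vectType K) (G : grading V) :
  (forall (br : cform G -> cform G -> cform G) (Omega : cform G),
     assoc_pinczon br Omega -> (forall x : V, Omega [:: x] = 0) ->
     (exists! B : V -> V -> K^o,
        symplectic_form G B /\ associated_symplectic br B)
     /\ (forall B : V -> V -> K^o, associated_symplectic br B ->
           exists! Q : seq V -> V,
             [/\ coderivation Q, B_quadratic G B Q
               & cval Omega = omega_of B Q]))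
  /\
  (forall b B : V -> V -> K^o, quadratic_form G b -> symplectic_of G b B ->
     forall Q : seq V -> V, A_infinity G Q -> B_quadratic G B Q ->
     exists! P : (cform G -> cform G -> cform G) * cform G,
       [/\ bracket_of b P.1, cval P.2 = omega_of B Q & assoc_pinczon P.1 P.2]).
Proof.
split=> [br Omega [brP O3 _] O1|b B]; last exact: pinczon_of_A_infinity.
split=> [|B [b [bQ _] bB]].
  have [n [d [e [eB eG]]]] := homogeneous_basis G.
  have bbr := bracket_form_of charK eB eG brP; have bQ := bbr.1.
  have [B bB] := symplectic_of_exists bQ.
  have [e' e'D] := dual_basis bQ eB.
  exists B; split.
    split; first exact: (symplectic_of_form bQ bB eB eG e'D).
    by exists (bracket_form eB eG br).
  move=> B' [_ [b' b'br b'B']].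
  rewrite (form_of_unique b'br bbr) in b'B'.
  exact: (symplectic_of_unique bB b'B').
(* What remains is the constant term: the empty word has degree 0, so a form of degree 3 vanishes on
   it. *)
apply: (coderivation_of_form bQ bB) => //.
have := O3 [::] isT; have [//|_] := eqVneq (Omega [::]) 0.
by move/(_ isT); rewrite /wdeg big_nil.
Qed.
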